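(* Let $H$ be a weak Hopf algebra with invertible antipode $S$. Let ${H_{par}^w}$ be its universal algebra of partial representations and ${A_{par}^w}\subseteq {H_{par}^w}$ the subalgebra generated by the elements $E_h=[h_1][S(h_2)]$, $h\in H$, regarded as a symmetric partial $H$-module algebra via $h\cdot a=[h_1]\,a\,[S(h_2)]$. Then ${H_{par}^w}$ is isomorphic, as an algebra, to the partial smash product ${A_{par}^w}\,\underline{\#}\,H$.
   Context: All algebras are associative and unital over a field $\Bbbk$; Sweedler notation $\Delta(h)=h_1\otimes h_2$, $\Delta(1_H)=1_1\otimes 1_2$. A weak Hopf algebra is $(H,m,u,\Delta,\varepsilon,S)$ with $H$ an algebra, $(H,\Delta,\varepsilon)$ a coalgebra, and for all $g,h,k$: $\Delta(kh)=\Delta(k)\Delta(h)$; $\varepsilon(kh_1)\varepsilon(h_2g)=\varepsilon(khg)=\varepsilon(kh_2)\varepsilon(h_1g)$; $(1\otimes\Delta(1))(\Delta(1)\otimes 1)=\Delta^2(1)=(\Delta(1)\otimes 1)(1\otimes\Delta(1))$; $h_1S(h_2)=\varepsilon_t(h)$; $S(h_1)h_2=\varepsilon_s(h)$; $S(h)=S(h_1)h_2S(h_3)$; where $\varepsilon_t(h)=\varepsilon(1_1h)1_2$, $\varepsilon_s(h)=1_1\varepsilon(h1_2)$. Put $H_t=\varepsilon_t(H)$, $H_s=\varepsilon_s(H)$; the restriction of $S$ gives a bijection $S_R\colon H_s\to H_t$. ${H_{par}^w}=T(H)/I$, where $T(H)$ is the tensor algebra of the vector space $H$ and $I$ is the ideal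 generated by, for all $h,k\in H$: $1_H-1_{T(H)}$; $h\otimes k_1\otimes S(k_2)-hk_1\otimes S(k_2)$; $h\otimes S(k_1)\otimes k_2-hS(k_1)\otimes k_2$; $h_1\otimes S(h_2)\otimes k-h_1\otimes S(h_2)k$; $S(h_1)\otimes h_2\otimes k-S(h_1)\otimes h_2k$; $h-h_1\otimes S(h_2)\otimes h_3$. $[h]$ denotes the class of $h$. A left partial action of $H$ on an algebra $A$ is a linear map $H\otimes A\to A$, $h\otimes a\mapsto h\cdot a$, with (PA1) $h\cdot(ab)=(h_1\cdot a)(h_2\cdot b)$, (PA2) $1_H\cdot a=a$, (PA3) $h\cdot(k\cdot a)=(h_1\cdot 1_A)((h_2k)\cdot a)$; $A$ is then a partial $H$-module algebra, and it is symmetric if moreover (PA4) $h\cdot(k\cdot a)=((h_1k)\cdot a)(h_2\cdot 1_A)$. For a partial $H$-module algebra $A$, the smash product $A\# H$ is $A\otimes_{H_t}H$, where $A$ is a right $H_t$-module via $a\triangleleft z=a(S_R^{-1}(z)\cdot 1_A)$ and $H$ is a left $H_t$-module by multiplication, with product $(a\#h)(b\#g)=a(h_1\cdot b)\#h_2g$. The partial smash product $A\,\underline{\#}\,H$ is the subalgebra of $A\#H$ generated by the elements $a\,\underline{\#}\,h:=(a\#h)(1_A\#1_H)=a(h_1\cdot 1_A)\#h_2$; it is unital with unit $1_A\,\underline{\#}\,1_H$. *)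

(* Defs.v *)
From HB Require Import structures.
From mathcomp Require Import all_boot all_order all_algebra.
Set Implicit Arguments. Unset Strict Implicit. Unset Printing Implicit Defensive.
Import Order.TTheory GRing.Theory Num.Theory.
Local Open Scope ring_scope.

Section Defs.
Variable F : fieldType.

Definition lin_functional (V : lmodType F) (f : V -> F) : Prop :=
  forall (c : F) (x y : V), f (c *: x + y) = c * f x + f y.

Definition lin_map (V W : lmodType F) (f : V -> W) : Prop :=
  forall (c : F) (x y : V), f (c *: x + y) = c *: f x + f y.

(* Equality in V (x) W resp. V (x) W (x) X of two formal sums of simple
   tensors.  Over a field, simple functionals f (x) g separate the points
   of a tensor product, so this is exactly equality of tensors. *)
Definition teq2 (V W : lmodType F) (s t : seq (V * W)) : Prop :=
  forall f g, lin_functional f -> lin_functional g ->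
    \sum_(p <- s) f p.1 * g p.2 = \sum_(p <- t) f p.1 * g p.2.

Definition teq3 (V W X : lmodType F) (s t : seq (V * W * X)) : Prop :=
  forall f g k, lin_functional f -> lin_functional g -> lin_functional k ->
    \sum_(p <- s) f p.1.1 * g p.1.2 * k p.2
    = \sum_(p <- t) f p.1.1 * g p.1.2 * k p.2.

Variable H : algType F.
(* Comultiplication: Delta h is a representative  sum_i (a_i, b_i)  of the
   tensor  Delta(h) = sum_i a_i (x) b_i  (Sweedler: h_1 (x) h_2). *)
Variable Delta : H -> seq (H * H).
Variable eps : H -> F.
Variable S : H -> H.

Definition eps_t (h : H) : H := \sum_(p <- Delta 1) eps (p.1 * h) *: p.2.
Definition eps_s (h : H) : H := \sum_(p <- Delta 1) eps (h * p.2) *: p.1.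

Definition is_weak_hopf_algebra : Prop :=
  [/\ forall c x y, teq2 (Delta (c *: x + y))
                         ([seq (c *: p.1, p.2) | p <- Delta x] ++ Delta y),
      lin_functional eps,
      forall h, teq3 [seq ((q.1, q.2), p.2) | p <- Delta h, q <- Delta p.1]
                     [seq ((p.1, q.1), q.2) | p <- Delta h, q <- Delta p.2],
      forall h, \sum_(p <- Delta h) eps p.1 *: p.2 = h
      & forall h, \sum_(p <- Delta h) eps p.2 *: p.1 = h] /\
  [/\ forall k h, teq2 (Delta (k * h))
                       [seq (p.1 * q.1, p.2 * q.2) | p <- Delta k, q <- Delta h],
      forall k h g,
        \sum_(p <- Delta h) eps (k * p.1) * eps (p.2 * g) = eps (k * h * g),
      forall k h g,
        eps (k * h * g) = \sum_(p <- Delta h) eps (k * p.2) * eps (p.1 * g),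
      teq3 [seq ((p.1, q.1 * p.2), q.2) | q <- Delta 1, p <- Delta 1]
           [seq ((q.1, q.2), p.2) | p <- Delta 1, q <- Delta p.1]
      & teq3 [seq ((q.1, q.2), p.2) | p <- Delta 1, q <- Delta p.1]
             [seq ((p.1, p.2 * q.1), q.2) | p <- Delta 1, q <- Delta 1]] /\
  [/\ lin_map S,
      forall h, \sum_(p <- Delta h) p.1 * S p.2 = eps_t h,
      forall h, \sum_(p <- Delta h) S p.1 * p.2 = eps_s h
      & forall h, S h = \sum_(p <- Delta h) \sum_(q <- Delta p.1)
                           S q.1 * q.2 * S p.2].

(* The relations defining the ideal I of T(H), evaluated under the algebra
   map T(H) -> C induced by a linear map rho : H -> C. *)
Definition satisfies_Hpar_relations (C : algType F) (rho : H -> C) : Prop :=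
  rho 1 = 1 /\
  [/\ forall h k, \sum_(p <- Delta k) rho h * rho p.1 * rho (S p.2)
                  = \sum_(p <- Delta k) rho (h * p.1) * rho (S p.2),
      forall h k, \sum_(p <- Delta k) rho h * rho (S p.1) * rho p.2
                  = \sum_(p <- Delta k) rho (h * S p.1) * rho p.2,
      forall h k, \sum_(p <- Delta h) rho p.1 * rho (S p.2) * rho k
                  = \sum_(p <- Delta h) rho p.1 * rho (S p.2 * k),
      forall h k, \sum_(p <- Delta h) rho (S p.1) * rho p.2 * rho k
                  = \sum_(p <- Delta h) rho (S p.1) * rho (p.2 * k)
    & forall h, rho h = \sum_(p <- Delta h) \sum_(q <- Delta p.1)
                          rho q.1 * rho (S q.2) * rho p.2].

Definition is_alg_hom (B C : algType F) (phi : B -> C) : Prop :=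
  [/\ lin_map phi, forall x y, phi (x * y) = phi x * phi y & phi 1 = 1].

(* (B, pi) is  H_par^w = T(H)/I  with  pi h = [h] : the quotient of the
   tensor algebra T(H) by I is characterised (up to a unique isomorphism
   compatible with pi) by this universal property. *)
Definition is_Hpar (B : algType F) (pi : H -> B) : Prop :=
  lin_map pi /\ satisfies_Hpar_relations pi /\
  forall (C : algType F) (rho : H -> C),
    lin_map rho -> satisfies_Hpar_relations rho ->
    (exists phi : B -> C, is_alg_hom phi /\ forall h, phi (pi h) = rho h) /\
    (forall phi psi : B -> C, is_alg_hom phi -> is_alg_hom psi ->
       (forall h, phi (pi h) = rho h) -> (forall h, psi (pi h) = rho h) ->
       forall x, phi x = psi x).

Section Apar.
Variables (B : algType F) (pi : H -> B).

Definition Ew (h : H) : B := \sum_(p <- Delta h) pi p.1 * pi (S p.2).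

Inductive Apar : B -> Prop :=
| Apar_E h : Apar (Ew h)
| Apar_1 : Apar 1
| Apar_add x y : Apar x -> Apar y -> Apar (x + y)
| Apar_scale (c : F) x : Apar x -> Apar (c *: x)
| Apar_mul x y : Apar x -> Apar y -> Apar (x * y).

Definition pact (h : H) (a : B) : B :=
  \sum_(p <- Delta h) pi p.1 * a * pi (S p.2).

Variable Sinv : H -> H.

Definition in_Ht (z : H) : Prop := exists h, z = eps_t h.

(* right H_t-module structure a <| z = a (S_R^{-1}(z) . 1_A) *)
Definition rtri (a : B) (z : H) : B := a * pact (Sinv z) 1.

Definition balanced (U : lmodType F) (f : B -> H -> U) : Prop :=
  [/\ forall c a a' h, Apar a -> Apar a' ->
        f (c *: a + a') h = c *: f a h + f a' h,
      forall c a h h', Apar a -> f a (c *: h + h') = c *: f a h + f a h'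
    & forall a z h, Apar a -> in_Ht z -> f (rtri a z) h = f a (z * h)].

Definition inAH (s : seq (B * H)) : Prop := forall p, p \in s -> Apar p.1.

(* equality in A (x)_{H_t} H of two formal sums of simple tensors a # h *)
Definition teqS (s t : seq (B * H)) : Prop :=
  inAH s /\ inAH t /\
  forall (U : lmodType F) (f : B -> H -> U), balanced f ->
    \sum_(p <- s) f p.1 p.2 = \sum_(p <- t) f p.1 p.2.

Definition sadd (s t : seq (B * H)) := s ++ t.
Definition sscale (c : F) (s : seq (B * H)) := [seq (c *: p.1, p.2) | p <- s].
Definition smul (s t : seq (B * H)) : seq (B * H) :=
  flatten [seq [seq (p.1 * pact q.1 r.1, q.2 * r.2) | q <- Delta p.2]
          | p <- s, r <- t].
Definition pgen (a : B) (h : H) : seq (B * H) := smul [:: (a, h)] [:: (1, 1)].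
Definition sunit : seq (B * H) := pgen 1 1.

Inductive PSP : seq (B * H) -> Prop :=
| PSP_gen a h : Apar a -> inAH (pgen a h) -> PSP (pgen a h)
| PSP_add s t : PSP s -> PSP t -> PSP (sadd s t)
| PSP_scale c s : PSP s -> PSP (sscale c s)
| PSP_mul s t : PSP s -> PSP t -> PSP (smul s t)
| PSP_eq s t : teqS s t -> PSP s -> PSP t.

(* algebra isomorphism  B ~= A _#_ H  (A _#_ H as a setoid algebra) *)
Definition iso_to_partial_smash (phi : B -> seq (B * H)) : Prop :=
  (forall x, PSP (phi x)) /\
  [/\ forall c x y, teqS (phi (c *: x + y)) (sadd (sscale c (phi x)) (phi y)),
      forall x y, teqS (phi (x * y)) (smul (phi x) (phi y)),
      teqS (phi 1) sunit,
      forall x y, teqS (phi x) (phi y) -> x = y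
    & forall s, PSP s -> exists x, teqS (phi x) s].

End Apar.
End Defs.

(* Main.v *)
Require Import Defs.
From HB Require Import structures.
From mathcomp Require Import all_boot all_order all_algebra.
From mathcomp Require Import boolp classical_sets functions.
Set Implicit Arguments. Unset Strict Implicit. Unset Printing Implicit Defensive.
Import GRing.Theory.
Local Open Scope ring_scope.

(** Write A for the subalgebra generated by the E_h.  Since
    [h][k] = sum E_{h_1} [h_2 k], the span of the products a [h] with a in A is
    a subalgebra containing every [h], hence is all of H_par by the universal
    property.  So the isomorphism must send a [h] to (a # h)(1 # 1), and the
    point is that this is well defined.  For that we let H_par act on
    functionals: for every U the balanced maps f : A x H -> U form a vector
    space on which 1 # h acts on the right by
    (f . h)(a, m) = sum f(h_1 . a, h_2 m), and h |-> (f |-> f . h) satisfies the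
    relations of H_par with values in the opposite endomorphism algebra.  The
    induced action of x = sum a_i [h_i] satisfies
    (f . x)(1, 1) = sum f(a_i E_{h_i1}, h_i2), so the right-hand side depends
    only on x; multiplicativity is f . (x y) = (f . x) . y.  The inverse map is
    a # h |-> a [h]. *)

(** * Linear algebra: tensors tested on multilinear maps *)

(** [Delta h] is only a list representing a tensor, and the axioms equate such lists under products
    of scalar functionals. Sweedler manipulations take values in arbitrary vector spaces, so
    vector-valued multilinear maps must first be shown to respect this equality; that is where
    Zorn's lemma enters. Likewise A (x)_{H_t} H is never formed: its elements are lists compared
    under all balanced maps, hence the action on those maps and the reversed composition. The
    obstacle is that Delta(1) may differ from 1 (x) 1. Three facts meet it: the legs of Delta(1) lie
    in H_s and H_t, the class [.] is multiplicative as soon as one factor lies in H_s or H_t, and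
    elements of H_s and H_t can be moved between the legs of Delta(h). Among the relations for f .
    h, those with S on the second leg and the last one rest on the fact that [h_1][S(h_2)] acts as
    left multiplication by E_h. Those with S on the first leg rest on Delta(S(h)) = S(h_2) (x)
    S(h_1) and on a formula for S(h_1) . (h_2 . a). The inverse of S enters through a <| z = a
    [z]. *)

Section LinearMaps.
Variable F : fieldType.
Implicit Types V W X U : lmodType F.

Section LinMapTheory.
Variables (V W : lmodType F) (f : V -> W).
Hypothesis fL : lin_map f.

Lemma lin_mapD x y : f (x + y) = f x + f y.
Proof. by have := fL 1 x y; rewrite !scale1r. Qed.

Lemma lin_map0 : f 0 = 0.
Proof. by apply: (addrI (f 0)); rewrite -lin_mapD !addr0. Qed.

Lemma lin_mapZ c x : f (c *: x) = c *: f x.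
Proof. by have := fL c x 0; rewrite lin_map0 !addr0. Qed.

Lemma lin_mapN x : f (- x) = - f x.
Proof. by rewrite -scaleN1r lin_mapZ scaleN1r. Qed.

Lemma lin_map_sum I (s : seq I) (g : I -> V) :
  f (\sum_(i <- s) g i) = \sum_(i <- s) f (g i).
Proof.
by elim: s => [|i s IH]; rewrite ?big_nil ?lin_map0 // !big_cons lin_mapD IH.
Qed.
End LinMapTheory.

Definition subspace V (P : V -> Prop) : Prop :=
  P 0 /\ forall c x y, P x -> P y -> P (c *: x + y).

(* A subspace maximal among those containing P and missing v is a hyperplane
   complementary to v; the functional reads off the v-coordinate. *)
Lemma separating_functional V (P : V -> Prop) (v : V) :
  subspace P -> ~ P v ->
  exists f : V -> F, [/\ lin_functional f, f v = 1 & forall x, P x -> f x = 0].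
Proof.
move=> subP nPv.
pose T := {Q : V -> Prop | [/\ subspace Q, ~ Q v & forall x, P x -> Q x]}.
pose t0 : T := exist _ P (And3 subP nPv (fun x Px => Px)).
pose R (p q : T) : bool := `[< forall x, sval p x -> sval q x >].
have [Q maxQ] : exists t, forall s, R t s -> R s t.
  apply: (ZL_preorder t0).
  - by move=> p; apply/asboolP.
  - by move=> p q r /asboolP pq /asboolP qr; apply/asboolP => x /pq /qr.
  move=> A totA; have [[a Aa]|nA] := pselect (exists a, A a); last first.
    by exists t0 => s As; case: nA; exists s.
  pose Q x := exists2 q : T, A q & sval q x.
  have subQ : subspace Q.
    split; first by exists a => //; case: (svalP a) => -[].
    move=> c x y [p Ap px] [q Aq qy].
    case: (totA _ _ Ap Aq) => /asboolP pq.
      exists q => //; case: (svalP q) => -[_ qL] _ _; apply: qL => //; exact: pq.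
    exists p => //; case: (svalP p) => -[_ pL] _ _; apply: pL => //; exact: pq.
  have nQv : ~ Q v by move=> [q Aq]; case: (svalP q).
  have PQ x : P x -> Q x by move=> Px; exists a => //; case: (svalP a) => _ _; apply.
  exists (exist _ Q (And3 subQ nQv PQ)) => s As; apply/asboolP => x sx.
  by exists s.
case: (svalP Q) => -[Q0 QL] nQv PQ; set q := sval Q in Q0 QL nQv PQ.
have QZ c x : q x -> q (c *: x) by move=> qx; rewrite -[_ *: _]addr0; exact: QL.
have QD x y : q x -> q y -> q (x + y).
  by move=> qx qy; rewrite -[x]scale1r; exact: QL.
have ex u : exists c : F, q (u - c *: v).
  have [qu|nqu] := pselect (q u); first by exists 0; rewrite scale0r subr0.
  (* [Q'] is the span of [q] and [u]. If it contains [v], solving for [u] gives its [v]-coordinate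
     modulo [q]; if not, maximality puts [u] in [q]. *)
  pose Q' x := exists2 c : F, True & q (x - c *: u).
  have [Q'v|nQ'v] := pselect (Q' v).
    case: Q'v => c _ qc; have c0 : c != 0.
      by apply: contra_not_neq nQv => c0; rewrite c0 scale0r subr0 in qc.
    exists c^-1; have := QZ (- c^-1) _ qc.
    by rewrite scalerBr scalerA mulNr mulVf // scaleN1r opprK addrC scaleNr.
  have subQ' : subspace Q'.
    split; first by exists 0 => //; rewrite scale0r subr0.
    move=> c x y [d _ qd] [e _ qe]; exists (c * d + e) => //.
    rewrite scalerDl opprD addrACA -scalerA -scalerBr; exact: QL.
  have PQ' x : P x -> Q' x.
    by move=> Px; exists 0 => //; rewrite scale0r subr0; exact: PQ.
  have := maxQ (exist _ Q' (And3 subQ' nQ'v PQ')).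
  have -> : R Q (exist _ Q' (And3 subQ' nQ'v PQ')).
    by apply/asboolP => x qx; exists 0 => //; rewrite scale0r subr0.
  move=> /(_ isT)/asboolP /(_ u) /= Q'Q; case: nqu; apply: Q'Q; exists 1 => //.
  by rewrite scale1r subrr.
have uniq c d u : q (u - c *: v) -> q (u - d *: v) -> c = d.
  move=> qc qd; apply/eqP; rewrite -subr_eq0; apply: contra_notT nQv => ncd.
  have := QD _ _ (QZ (-1) _ qc) qd.
  rewrite scaleN1r opprB addrA subrK -scalerBl => /(QZ (c - d)^-1).
  by rewrite scalerA mulVf // scale1r.
have [f fP] := choice ex; exists f; split.
- move=> c x y; apply: uniq (fP _) _; rewrite scalerDl opprD addrACA -scalerA.
  rewrite -scalerBr; exact: QL.
- by apply: uniq (fP _) _; rewrite scale1r subrr.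
by move=> x Px; apply: uniq (fP _) _; rewrite scale0r subr0; exact: PQ.
Qed.

Lemma functionals_separate V (x : V) :
  (forall f : V -> F, lin_functional f -> f x = 0) -> x = 0.
Proof.
move=> fx0; apply/eqP; apply/negP => /negP x0.
have [||f [fL f1 _]] := @separating_functional V (fun y => y = 0) x.
- by split=> // c y z -> ->; rewrite scaler0 addr0.
- exact/eqP.
by have := fx0 f fL; rewrite f1 => /eqP; rewrite oner_eq0.
Qed.

(** * Contraction of tensors given by lists of pairs *)

Section Trace.
Variables (V U : lmodType F).
Implicit Types (s : seq (V * (V -> U))) (v : V) (g : V -> U).

(** Only the vectors span; the attached maps ride along so that [in_span_absorb] can alter them by
    recursion on the same list. *)
Fixpoint in_span s v : Prop :=
  if s is p :: s' then exists c : F, in_span s' (v - c *: p.1) else v = 0.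

Lemma subspace_in_span s : subspace (in_span s).
Proof.
elim: s => [|p s [IH0 IHL]]; first by split=> // c x y /= -> ->; rewrite scaler0 addr0.
split; first by exists 0; rewrite scale0r subr0.
move=> c x y [d Hd] [e He]; exists (c * d + e).
rewrite scalerDl opprD addrACA -scalerA -scalerBr; exact: IHL.
Qed.

Lemma mem_in_span s p : p \in s -> in_span s p.1.
Proof.
elim: s => // q s IH; rewrite inE => /predU1P [->|/IH qs] /=; last by exists 0; rewrite scale0r subr0.
by exists 1; rewrite scale1r subrr; case: (subspace_in_span s).
Qed.

Definition all_lin s := forall p, p \in s -> lin_map p.2.

(** If v = sum c_i w_i, then v (x) g is merged by adding c_i g to the i-th map. The tensor gains v
    (x) g while the length stays the same, which drives the induction in [contraction_eq0]. *)
Lemma in_span_absorb s v g : all_lin s -> lin_map g -> in_span s v ->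
  exists s', [/\ size s' = size s, all_lin s',
    \sum_(p <- s') p.2 p.1 = \sum_(p <- s) p.2 p.1 + g v &
    forall (f : V -> F) u, lin_functional f ->
      \sum_(p <- s') f p.1 *: p.2 u = \sum_(p <- s) f p.1 *: p.2 u + f v *: g u].
Proof.
elim: s v => [|[w h] s IH] v sL gL /=.
  move=> ->; exists [::]; split=> // [|f u fL]; rewrite !big_nil add0r.
    by rewrite (lin_map0 gL).
  by rewrite (lin_map0 (fL : @lin_map F V F^o f)) scale0r.
move=> [c /IH [||s' [sz s'L e1 e2]]] //; first by move=> p ps; apply: sL; rewrite inE ps orbT.
have hL : lin_map h by apply: (sL (w, h)); rewrite inE eqxx.
exists ((w, fun u => h u + c *: g u) :: s'); split=> /=; first by rewrite sz.
- move=> p; rewrite inE => /predU1P [->|]; last exact: s'L.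
  move=> d x y /=; rewrite hL gL !scalerDr addrACA !scalerA [c * d]mulrC.
  by rewrite -!addrA.
- rewrite !big_cons /= e1 (lin_mapD gL) (lin_mapN gL) (lin_mapZ gL).
  by rewrite addrACA [c *: _ + _]addrC subrK.
- move=> f u fL; rewrite !big_cons /= e2 //.
  have fL' : @lin_map F V F^o f by [].
  rewrite (lin_mapD fL') (lin_mapN fL') (lin_mapZ fL') scalerDr scalerDl scaleNr.
  rewrite addrACA scalerA [f w * c]mulrC; congr (_ + _).
by rewrite addrC subrK.
Qed.

(** Induction on the length: a head vector in the span of the others is absorbed into them;
    otherwise a functional equal to 1 on it and 0 on the others forces its map to be zero. In
    effect, evaluation V (x) Hom(V, U) -> U is well defined on lists. *)
Lemma contraction_eq0 s : all_lin s ->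
  (forall (f : V -> F) u, lin_functional f -> \sum_(p <- s) f p.1 *: p.2 u = 0) ->
  \sum_(p <- s) p.2 p.1 = 0.
Proof.
have [n] := ubnP (size s); elim: n s => // n IH [|[v g] s] /=; first by rewrite big_nil.
move=> szs sL s0; have gL : lin_map g by apply: (sL (v, g)); rewrite inE eqxx.
have sL' : all_lin s by move=> p ps; apply: sL; rewrite inE ps orbT.
have [vs|nvs] := pselect (in_span s v).
  have [s' [sz s'L e1 e2]] := in_span_absorb sL' gL vs.
  rewrite big_cons /= addrC -e1; apply: IH => //; first by rewrite sz.
  by move=> f u fL; rewrite e2 // -[RHS](s0 f u fL) big_cons /= addrC.
have [f [fL fv fs]] := separating_functional (subspace_in_span s) nvs.
have g0 u : g u = 0.
  rewrite -(s0 f u fL) big_cons /= fv scale1r.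
  suff -> : \sum_(p <- s) f p.1 *: p.2 u = 0 by rewrite addr0.
  have : forall p, p \in s -> f p.1 = 0 by move=> p /mem_in_span /fs.
  elim: (s) => [|p s' IHs] ps; first by rewrite big_nil.
  rewrite big_cons ps ?scale0r ?add0r ?inE ?eqxx //.
  by apply: IHs => q qs; apply: ps; rewrite inE qs orbT.
rewrite big_cons /= g0 add0r; apply: IH => // e u eL.
by rewrite -[RHS](s0 e u eL) big_cons /= g0 scaler0 add0r.
Qed.
End Trace.

Definition bilin V W U (f : V -> W -> U) : Prop :=
  (forall y, lin_map (f^~ y)) /\ (forall x, lin_map (f x)).

Definition trilin V W X U (f : V -> W -> X -> U) : Prop :=
  [/\ forall y z, lin_map (fun x => f x y z), forall x z, lin_map (fun y => f x y z)
    & forall x y, lin_map (f x y)].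

Lemma all_lin_map V U (I : eqType) (s : seq I) (a : I -> V) (b : I -> V -> U) :
  (forall i, lin_map (b i)) -> all_lin [seq (a i, b i) | i <- s].
Proof. by move=> bL p /mapP [i _ ->]; exact: bL. Qed.

(** Pair each first leg with the map f(-, second leg) and contract. For fixed e and u the test
    concerns f(u, sum e(p_1) p_2), whose argument is determined by scalar functionals, hence by
    [teq2]. *)
Lemma teq2_bilin V W U (s t : seq (V * W)) (f : V -> W -> U) :
  teq2 s t -> bilin f ->
  \sum_(p <- s) f p.1 p.2 = \sum_(p <- t) f p.1 p.2.
Proof.
move=> st [fL1 fL2]; apply/eqP; rewrite -subr_eq0 -sumrN; apply/eqP.
have := @contraction_eq0 V U
  ([seq (p.1, f^~ p.2) | p <- s] ++ [seq (- p.1, f^~ p.2) | p <- t]).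
rewrite big_cat !big_map /=.
under [X in _ -> _ -> _ + X = 0]eq_bigr do rewrite (lin_mapN (fL1 _)).
apply.
  by move=> p; rewrite mem_cat => /orP [] /all_lin_map; apply.
move=> e u eL; rewrite big_cat !big_map /=.
have eL' : @lin_map F V F^o e by [].
under eq_bigr do rewrite -(lin_mapZ (fL2 _)).
under [X in _ + X]eq_bigr do rewrite -(lin_mapZ (fL2 _)).
rewrite -!(lin_map_sum (fL2 _)) -(lin_mapD (fL2 _)) -[RHS](lin_map0 (fL2 u)).
congr (f u _); apply: functionals_separate => g gL.
have gL' : @lin_map F W F^o g by [].
rewrite (lin_mapD gL') !(lin_map_sum gL').
under eq_bigr do rewrite (lin_mapZ gL').
under [X in _ + X]eq_bigr do rewrite (lin_mapZ gL') (lin_mapN eL') scaleNr.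
rewrite sumrN; apply/eqP; rewrite subr_eq0; apply/eqP; exact: st.
Qed.

Lemma teq3_trilin V W X U (s t : seq (V * W * X)) (f : V -> W -> X -> U) :
  teq3 s t -> trilin f ->
  \sum_(p <- s) f p.1.1 p.1.2 p.2 = \sum_(p <- t) f p.1.1 p.1.2 p.2.
Proof.
move=> st [fL1 fL2 fL3]; apply/eqP; rewrite -subr_eq0 -sumrN; apply/eqP.
have := @contraction_eq0 V U
  ([seq (p.1.1, fun v => f v p.1.2 p.2) | p <- s]
   ++ [seq (- p.1.1, fun v => f v p.1.2 p.2) | p <- t]).
rewrite big_cat !big_map /=.
under [X in _ -> _ -> _ + X = 0]eq_bigr do rewrite (lin_mapN (fL1 _ _)).
apply.
  by move=> p; rewrite mem_cat => /orP [] /all_lin_map; apply.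
move=> e u eL; rewrite big_cat !big_map /=.
have eL' : @lin_map F V F^o e by [].
under [X in _ + X]eq_bigr do rewrite (lin_mapN eL') scaleNr.
rewrite sumrN; apply/eqP; rewrite subr_eq0; apply/eqP.
under eq_bigr do rewrite -(lin_mapZ (fL2 _ _)).
under [RHS]eq_bigr do rewrite -(lin_mapZ (fL2 _ _)).
(* Once a functional is fixed on the first leg, the two remaining legs satisfy [teq2]. *)
have := @teq2_bilin W X U [seq (e p.1.1 *: p.1.2, p.2) | p <- s]
  [seq (e p.1.1 *: p.1.2, p.2) | p <- t] (f u).
rewrite !big_map /=; apply; last by split.
move=> g k gL kL; rewrite !big_map /=.
have gL' : @lin_map F W F^o g by [].
under eq_bigr do rewrite (lin_mapZ gL').
under [RHS]eq_bigr do rewrite (lin_mapZ gL').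
exact: st.
Qed.

End LinearMaps.

(** * Sweedler calculus *)

Section LinearityRules.
Variables (F : fieldType) (V W U : lmodType F) (C : algType F).

Lemma lin_id : lin_map (fun x : V => x).
Proof. by []. Qed.

Lemma lin_comp (f : W -> U) (g : V -> W) :
  lin_map f -> lin_map g -> lin_map (fun x => f (g x)).
Proof. by move=> fL gL c x y; rewrite gL fL. Qed.

Lemma lin_mull (c : C) (g : V -> C) : lin_map g -> lin_map (fun x => c * g x).
Proof. by move=> gL d x y; rewrite gL mulrDr scalerAr. Qed.

Lemma lin_mulr (c : C) (g : V -> C) : lin_map g -> lin_map (fun x => g x * c).
Proof. by move=> gL d x y; rewrite gL mulrDl scalerAl. Qed.

Lemma lin_scaler (c : F) (g : V -> U) : lin_map g -> lin_map (fun x => c *: g x).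
Proof. by move=> gL d x y; rewrite gL scalerDr !scalerA mulrC. Qed.

Lemma lin_scalel (e : W -> F) (g : V -> W) (u : U) :
  lin_functional e -> lin_map g -> lin_map (fun x => e (g x) *: u).
Proof. by move=> eL gL d x y; rewrite gL eL scalerDl scalerA. Qed.

Lemma bilin_lin1 (X : lmodType F) (f : W -> X -> U) (g : V -> W) (y : X) :
  bilin f -> lin_map g -> lin_map (fun x => f (g x) y).
Proof. by move=> [fL _] gL; exact: (lin_comp (fL y)). Qed.

Lemma bilin_lin2 (X : lmodType F) (f : X -> W -> U) (g : V -> W) (y : X) :
  bilin f -> lin_map g -> lin_map (fun x => f y (g x)).
Proof. by move=> [_ fL] gL; exact: (lin_comp (fL y)). Qed.

Lemma trilin_lin1 (X Y : lmodType F) (f : W -> X -> Y -> U) (g : V -> W) y z :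
  trilin f -> lin_map g -> lin_map (fun x => f (g x) y z).
Proof. by move=> [fL _ _] gL; exact: (lin_comp (fL y z)). Qed.

Lemma trilin_lin2 (X Y : lmodType F) (f : X -> W -> Y -> U) (g : V -> W) y z :
  trilin f -> lin_map g -> lin_map (fun x => f y (g x) z).
Proof. by move=> [_ fL _] gL; exact: (lin_comp (fL y z)). Qed.

Lemma trilin_lin3 (X Y : lmodType F) (f : X -> Y -> W -> U) (g : V -> W) y z :
  trilin f -> lin_map g -> lin_map (fun x => f y z (g x)).
Proof. by move=> [_ _ fL] gL; exact: (lin_comp (fL y z)). Qed.

End LinearityRules.

(* Sweedler sums: [\sw_(a, b <- h) f a b] is  f(h_1, h_2). *)
Definition sw (F : fieldType) (H : algType F) (Delta : H -> seq (H * H))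
    (U : lmodType F) (h : H) (f : H -> H -> U) : U :=
  \sum_(p <- Delta h) f p.1 p.2.

Section Sweedler.
Variables (F : fieldType) (H : algType F) (Delta : H -> seq (H * H)).
Variables (eps : H -> F) (S : H -> H).
Hypothesis HH : is_weak_hopf_algebra Delta eps S.
Local Notation "\sw_ ( a , b <- h ) E" := (sw Delta h (fun a b => E))
  (at level 41, a name, b name, h at level 70, E at level 41,
   format "\sw_ ( a ,  b  <-  h )  E").
Local Notation eps_t := (eps_t Delta eps).
Local Notation eps_s := (eps_s Delta eps).
Implicit Types (U V W : lmodType F) (h k g : H).

Lemma eq_sw U h (f g : H -> H -> U) :
  (forall a b, f a b = g a b) -> sw Delta h f = sw Delta h g.
Proof. by move=> fg; apply: eq_bigr => p _; exact: fg. Qed.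

Lemma lin_sw U W h (g : U -> W) (f : H -> H -> U) :
  lin_map g -> g (sw Delta h f) = \sw_(a, b <- h) g (f a b).
Proof. by move=> gL; exact: lin_map_sum. Qed.

Lemma sw_exchange U h k (f : H -> H -> H -> H -> U) :
  \sw_(a, b <- h) (\sw_(c, d <- k) f a b c d) =
  \sw_(c, d <- k) (\sw_(a, b <- h) f a b c d).
Proof. exact: exchange_big. Qed.

Lemma swZ U h c (f : H -> H -> U) : c *: sw Delta h f = \sw_(a, b <- h) c *: f a b.
Proof. exact: scaler_sumr. Qed.

Lemma sw_mulr (C : algType F) h (f : H -> H -> C) x :
  sw Delta h f * x = \sw_(a, b <- h) f a b * x.
Proof. exact: mulr_suml. Qed.

Lemma sw_mull (C : algType F) h (f : H -> H -> C) x :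
  x * sw Delta h f = \sw_(a, b <- h) x * f a b.
Proof. exact: mulr_sumr. Qed.

Lemma lin_sw_arg U V h (f : V -> H -> H -> U) :
  (forall a b, lin_map (fun x => f x a b)) -> lin_map (fun x => sw Delta h (f x)).
Proof.
move=> fL c x y; rewrite /sw scaler_sumr -big_split /=.
by apply: eq_bigr => p _; exact: fL.
Qed.

Lemma sw_lin U V (g : V -> H) (f : H -> H -> U) :
  bilin f -> lin_map g -> lin_map (fun x => sw Delta (g x) f).
Proof.
move=> fL gL c x y; rewrite gL.
have [[DL _ _ _ _] _] := HH; rewrite /sw (teq2_bilin (DL _ _ _) fL).
rewrite big_cat big_map /= scaler_sumr; congr (_ + _); apply: eq_bigr => p _.
exact: (lin_mapZ (fL.1 _)).
Qed.

Lemma epsL : lin_functional eps.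
Proof. by have [[_ eL _ _ _] _] := HH. Qed.

Lemma SL : lin_map S.
Proof. by have [_ [_ [SL _ _ _]]] := HH. Qed.

End Sweedler.

Arguments eq_sw {F H Delta U h f g}.
Arguments lin_sw {F H Delta U W h g f}.

Create HintDb lin.

(** Every Sweedler rewriting leaves a linearity side condition, which [lin] discharges by descending
    through the term. [lin_extra] is a hook, redefined once balanced maps are available. *)
Ltac lin_extra := fail.
Ltac lin :=
  cbv beta;
  match goal with
  | |- bilin _ => solve [eassumption | split=> ?; lin]
  | |- trilin _ => solve [eassumption | split=> ? ?; lin]
  | |- lin_map (fun x => x) => exact: lin_id
  | |- lin_map (fun x => sw _ ?h (@?f x)) => apply: (@lin_sw_arg _ _ _ _ _ _ f) => ? ?; lin
  | |- lin_map (fun x => sw _ (@?g x) ?f) =>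
      apply: (@sw_lin _ _ _ _ _ ltac:(eassumption) _ _ g f); lin
  | |- lin_map (fun x => GRing.mul ?c (@?g x)) => apply: (@lin_mull _ _ _ c g); lin
  | |- lin_map (fun x => GRing.mul (@?g x) ?c) => apply: (@lin_mulr _ _ _ c g); lin
  | |- lin_map (fun x => GRing.scale ?c (@?g x)) => apply: (@lin_scaler _ _ _ c g); lin
  | |- lin_map (fun x => GRing.scale (?e (@?g x)) ?c) =>
      apply: (@lin_scalel _ _ _ _ e g c); [by eauto with lin | lin]
  | |- lin_map (fun x => ?f (@?g x)) =>
      apply: (@lin_comp _ _ _ _ f g); [by eauto with lin | lin]
  | K : bilin ?f |- lin_map (fun x => ?f _ (@?g x)) => apply: (@bilin_lin2 _ _ _ _ _ _ g _ K); lin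
  | K : bilin ?f |- lin_map (fun x => ?f (@?g x) _) => apply: (@bilin_lin1 _ _ _ _ _ _ g _ K); lin
  | K : trilin ?f |- lin_map (fun x => ?f _ _ (@?g x)) => apply: (@trilin_lin3 _ _ _ _ _ _ _ g _ _ K); lin
  | K : trilin ?f |- lin_map (fun x => ?f _ (@?g x) _) => apply: (@trilin_lin2 _ _ _ _ _ _ _ g _ _ K); lin
  | K : trilin ?f |- lin_map (fun x => ?f (@?g x) _ _) => apply: (@trilin_lin1 _ _ _ _ _ _ _ g _ _ K); lin
  | K : bilin ?f |- lin_map (?f _) => apply: K.2
  | K : trilin ?f |- lin_map (?f _ _) => case: K => _ _; apply
  | |- lin_map (fun x => ?f (@?g x) ?c) =>
      apply: (@lin_comp _ _ _ _ (fun z => f z c) g); [by eauto with lin | lin]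
  | |- lin_map _ => solve [eauto with lin]
  | |- _ => lin_extra
  end.
#[local] Hint Extern 1 (lin_map _) => (apply: SL; eassumption) : lin.
#[local] Hint Extern 1 (lin_functional _) => (apply: epsL; eassumption) : lin.

Section WeakHopf.
Variables (F : fieldType) (H : algType F) (Delta : H -> seq (H * H)).
Variables (eps : H -> F) (S : H -> H).
Hypothesis HH : is_weak_hopf_algebra Delta eps S.
Local Notation "\sw_ ( a , b <- h ) E" := (sw Delta h (fun a b => E))
  (at level 41, a name, b name, h at level 70, E at level 41,
   format "\sw_ ( a ,  b  <-  h )  E").
Local Notation eps_t := (eps_t Delta eps).
Local Notation eps_s := (eps_s Delta eps).
Implicit Types (U V W : lmodType F) (h k g : H).

Lemma sw_coassoc U h (f : H -> H -> H -> U) : trilin f ->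
  \sw_(a, b <- h) (\sw_(c, d <- a) f c d b) =
  \sw_(a, b <- h) (\sw_(c, d <- b) f a c d).
Proof.
move=> fL; have [[_ _ /(_ h) cA _ _] _] := HH.
by have := teq3_trilin cA fL; rewrite !big_allpairs_dep.
Qed.

Lemma swM U k h (f : H -> H -> U) : bilin f ->
  sw Delta (k * h) f = \sw_(a, b <- k) (\sw_(c, d <- h) f (a * c) (b * d)).
Proof.
move=> fL; have [_ [[/(_ k h) DM _ _ _ _] _]] := HH.
by have := teq2_bilin DM fL; rewrite big_allpairs_dep.
Qed.

Lemma sw_counitl U h (f : H -> U) : lin_map f ->
  \sw_(a, b <- h) eps a *: f b = f h.
Proof.
move=> fL; have [[_ _ _ /(_ h) eh _] _] := HH.
rewrite -[in RHS]eh (lin_map_sum fL); apply: eq_bigr => p _.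
by rewrite (lin_mapZ fL).
Qed.

Lemma sw_counitr U h (f : H -> U) : lin_map f ->
  \sw_(a, b <- h) eps b *: f a = f h.
Proof.
move=> fL; have [[_ _ _ _ /(_ h) eh] _] := HH.
rewrite -[in RHS]eh (lin_map_sum fL); apply: eq_bigr => p _.
by rewrite (lin_mapZ fL).
Qed.

(** Of the two factorisations of Delta^2(1), this one has middle leg 1'_1 1_2 and [sw1_21] has 1_2
    1'_1. Comparing them makes H_s and H_t commute. *)
Lemma sw1_12 U (f : H -> H -> H -> U) : trilin f ->
  \sw_(a, b <- 1) (\sw_(c, d <- a) f c d b) =
  \sw_(q, r <- 1) (\sw_(a, b <- 1) f a (q * b) r).
Proof.
move=> fL; have [_ [[_ _ _ e _] _]] := HH.
by have := teq3_trilin e fL; rewrite !big_allpairs_dep => /esym.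
Qed.

Lemma sw1_21 U (f : H -> H -> H -> U) : trilin f ->
  \sw_(a, b <- 1) (\sw_(c, d <- a) f c d b) =
  \sw_(a, b <- 1) (\sw_(q, r <- 1) f a (b * q) r).
Proof.
move=> fL; have [_ [[_ _ _ _ e] _]] := HH.
by have := teq3_trilin e fL; rewrite !big_allpairs_dep.
Qed.

Lemma eps_mul12 U k g (u : U) :
  \sw_(a, b <- 1) eps (k * a) *: (eps (b * g) *: u) = eps (k * g) *: u.
Proof.
have [_ [[_ e _ _ _] _]] := HH; rewrite -[k in RHS]mulr1 -e.
by rewrite scaler_suml; apply: eq_bigr => p _; rewrite scalerA.
Qed.

Lemma eps_mul21 U k g (u : U) :
  \sw_(a, b <- 1) eps (k * b) *: (eps (a * g) *: u) = eps (k * g) *: u.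
Proof.
have [_ [[_ _ e _ _] _]] := HH; rewrite -[k in RHS]mulr1 e.
by rewrite scaler_suml; apply: eq_bigr => p _; rewrite scalerA.
Qed.

Lemma S_convr h : \sw_(a, b <- h) a * S b = eps_t h.
Proof. by have [_ [_ [_ e _ _]]] := HH; exact: e. Qed.

Lemma S_convl h : \sw_(a, b <- h) S a * b = eps_s h.
Proof. by have [_ [_ [_ _ e _]]] := HH; exact: e. Qed.

Lemma eps_tL : lin_map eps_t.
Proof. change (lin_map (fun h => \sw_(a, b <- 1) eps (a * h) *: b)); lin. Qed.

Lemma eps_sL : lin_map eps_s.
Proof. change (lin_map (fun h => \sw_(a, b <- 1) eps (h * b) *: a)); lin. Qed.

End WeakHopf.
#[local] Hint Extern 1 (lin_map (eps_t _ _)) => (apply: eps_tL; eassumption) : lin.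
#[local] Hint Extern 1 (lin_map (eps_s _ _)) => (apply: eps_sL; eassumption) : lin.

(** * Source and target subalgebras *)

Section Bases.
Variables (F : fieldType) (H : algType F) (Delta : H -> seq (H * H)).
Variables (eps : H -> F) (S : H -> H).
Hypothesis HH : is_weak_hopf_algebra Delta eps S.
Local Notation "\sw_ ( a , b <- h ) E" := (sw Delta h (fun a b => E))
  (at level 41, a name, b name, h at level 70, E at level 41,
   format "\sw_ ( a ,  b  <-  h )  E").
Local Notation eps_t := (eps_t Delta eps).
Local Notation eps_s := (eps_s Delta eps).
Implicit Types (U V W : lmodType F) (h k g : H).

(** H_t and H_s are encoded as fixed points, usable as rewriting rules; they agree with the images
    because [eps_t] and [eps_s] are idempotent. *)
Definition is_t z := eps_t z = z.
Definition is_s x := eps_s x = x.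

Lemma eps_tE h : eps_t h = \sw_(a, b <- 1) eps (a * h) *: b. Proof. by []. Qed.
Lemma eps_sE h : eps_s h = \sw_(a, b <- 1) eps (h * b) *: a. Proof. by []. Qed.

Lemma eps_mul_t k h : eps (k * eps_t h) = eps (k * h).
Proof.
have eL : @lin_map F _ F^o (fun y => eps (k * y)).
  by move=> c x y; rewrite mulrDr -scalerAr (epsL HH).
rewrite eps_tE (lin_sw eL) -[RHS]mulr1.
apply: etrans (eps_mul21 HH k h (1 : F^o)); apply: eq_sw => a b.
by rewrite -scalerAr (lin_mapZ (epsL HH : @lin_map F _ F^o eps)) [eps (a * h) *: 1]mulr1; exact: mulrC.
Qed.

Lemma eps_s_mul k h : eps (eps_s k * h) = eps (k * h).
Proof.
have eL : @lin_map F _ F^o (fun y => eps (y * h)).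
  by move=> c x y; rewrite mulrDl -scalerAl (epsL HH).
rewrite eps_sE (lin_sw eL) -[RHS]mulr1.
apply: etrans (eps_mul21 HH k h (1 : F^o)); apply: eq_sw => a b.
by rewrite -scalerAl (lin_mapZ (epsL HH : @lin_map F _ F^o eps)) [eps (a * h) *: 1]mulr1.
Qed.

Lemma eps_tM h k : eps_t (h * eps_t k) = eps_t (h * k).
Proof. by rewrite !eps_tE; apply: eq_sw => a b; rewrite !mulrA eps_mul_t. Qed.

Lemma eps_sM h k : eps_s (eps_s h * k) = eps_s (h * k).
Proof. by rewrite !eps_sE; apply: eq_sw => a b; rewrite -!mulrA eps_s_mul. Qed.

Lemma is_t_eps_t h : is_t (eps_t h).
Proof. by have := eps_tM 1 h; rewrite !mul1r. Qed.

Lemma is_s_eps_s h : is_s (eps_s h).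
Proof. by have := eps_sM h 1; rewrite !mulr1. Qed.

Lemma eps_t1 : eps_t 1 = 1.
Proof.
rewrite eps_tE -[RHS](sw_counitl HH _ (f := id)) //.
by apply: eq_sw => a b; rewrite mulr1.
Qed.

Lemma eps_s1 : eps_s 1 = 1.
Proof.
rewrite eps_sE -[RHS](sw_counitr HH _ (f := id)) //.
by apply: eq_sw => a b; rewrite mul1r.
Qed.

(** From z = eps(1_1 z) 1_2 one gets Delta(z) = eps(1_1 z) 1_2 (x) 1_3, and a factorisation of
    Delta^2(1) leaves 1_1 z (x) 1_2. The other factorisation puts z on the left; for H_s the same
    argument acts on the second leg. *)
Lemma sw_t U z (f : H -> H -> U) : is_t z -> bilin f ->
  sw Delta z f = \sw_(a, b <- 1) f (a * z) b.
Proof.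
move=> zT fL; rewrite -{1}zT eps_tE (lin_sw (g := fun y => sw Delta y f)); last by lin.
rewrite (eq_sw (g := fun a b => \sw_(c, d <- b) eps (a * z) *: f c d)); last first.
  by move=> a b; rewrite (lin_mapZ (f := fun y => sw Delta y f)) ?swZ //; lin.
rewrite -(sw_coassoc HH _ (f := fun a c d => eps (a * z) *: f c d)); last by lin.
rewrite (sw1_12 HH (f := fun a c d => eps (a * z) *: f c d)); last by lin.
apply: eq_sw => q r; rewrite -{2}zT eps_tE (lin_sw (g := fun y => f (q * y) r)); last by lin.
by apply: eq_sw => a b; rewrite (lin_mapZ (f := fun y => f (q * y) r)) //; lin.
Qed.

Lemma sw_t' U z (f : H -> H -> U) : is_t z -> bilin f ->
  sw Delta z f = \sw_(a, b <- 1) f (z * a) b.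
Proof.
move=> zT fL; rewrite -{1}zT eps_tE (lin_sw (g := fun y => sw Delta y f)); last by lin.
rewrite (eq_sw (g := fun a b => \sw_(c, d <- b) eps (a * z) *: f c d)); last first.
  by move=> a b; rewrite (lin_mapZ (f := fun y => sw Delta y f)) ?swZ //; lin.
rewrite -(sw_coassoc HH _ (f := fun a c d => eps (a * z) *: f c d)); last by lin.
rewrite (sw1_21 HH (f := fun a c d => eps (a * z) *: f c d)); last by lin.
rewrite sw_exchange.
apply: eq_sw => q r; rewrite -{2}zT eps_tE (lin_sw (g := fun y => f (y * q) r)); last by lin.
by apply: eq_sw => a b; rewrite (lin_mapZ (f := fun y => f (y * q) r)) //; lin.
Qed.

Lemma sw_s U x (f : H -> H -> U) : is_s x -> bilin f ->
  sw Delta x f = \sw_(a, b <- 1) f a (x * b).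
Proof.
move=> xS fL; rewrite -{1}xS eps_sE (lin_sw (g := fun y => sw Delta y f)); last by lin.
rewrite (eq_sw (g := fun a b => \sw_(c, d <- a) eps (x * b) *: f c d)); last first.
  by move=> a b; rewrite (lin_mapZ (f := fun y => sw Delta y f)) ?swZ //; lin.
rewrite (sw1_12 HH (f := fun c d b => eps (x * b) *: f c d)); last by lin.
rewrite sw_exchange.
apply: eq_sw => q r; rewrite -{2}xS eps_sE (lin_sw (g := fun y => f q (y * r))); last by lin.
by apply: eq_sw => a b; rewrite (lin_mapZ (f := fun y => f q (y * r))) //; lin.
Qed.

Lemma sw_s' U x (f : H -> H -> U) : is_s x -> bilin f ->
  sw Delta x f = \sw_(a, b <- 1) f a (b * x).
Proof.
move=> xS fL; rewrite -{1}xS eps_sE (lin_sw (g := fun y => sw Delta y f)); last by lin.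
rewrite (eq_sw (g := fun a b => \sw_(c, d <- a) eps (x * b) *: f c d)); last first.
  by move=> a b; rewrite (lin_mapZ (f := fun y => sw Delta y f)) ?swZ //; lin.
rewrite (sw1_21 HH (f := fun c d b => eps (x * b) *: f c d)); last by lin.
apply: eq_sw => q r; rewrite -{2}xS eps_sE (lin_sw (g := fun y => f q (r * y))); last by lin.
by apply: eq_sw => a b; rewrite (lin_mapZ (f := fun y => f q (r * y))) //; lin.
Qed.

Lemma swMt U h z (f : H -> H -> U) : is_t z -> bilin f ->
  sw Delta (h * z) f = \sw_(a, b <- h) f (a * z) b.
Proof.
move=> zT fL; rewrite (swM HH) // -[h in RHS]mulr1 (swM HH); last by lin.
apply: eq_sw => a b; rewrite (sw_t zT); last by lin.
by apply: eq_sw => c d; rewrite mulrA.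
Qed.

Lemma swtM U h z (f : H -> H -> U) : is_t z -> bilin f ->
  sw Delta (z * h) f = \sw_(a, b <- h) f (z * a) b.
Proof.
move=> zT fL; rewrite (swM HH) // -[h in RHS]mul1r (swM HH); last by lin.
rewrite (sw_t' zT); last by lin.
by apply: eq_sw => c d; apply: eq_sw => a b; rewrite mulrA.
Qed.

Lemma swMs U h x (f : H -> H -> U) : is_s x -> bilin f ->
  sw Delta (h * x) f = \sw_(a, b <- h) f a (b * x).
Proof.
move=> xS fL; rewrite (swM HH) // -[h in RHS]mulr1 (swM HH); last by lin.
apply: eq_sw => a b; rewrite (sw_s' xS); last by lin.
by apply: eq_sw => c d; rewrite mulrA.
Qed.

Lemma swsM U h x (f : H -> H -> U) : is_s x -> bilin f ->
  sw Delta (x * h) f = \sw_(a, b <- h) f a (x * b).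
Proof.
move=> xS fL; rewrite (swM HH) // -[h in RHS]mul1r (swM HH); last by lin.
rewrite (sw_s xS); last by lin.
by apply: eq_sw => c d; apply: eq_sw => a b; rewrite mulrA.
Qed.

(** Apply eps(x -) to the second leg of 1_1 z (x) 1_2 = z 1_1 (x) 1_2, both sides being Delta(z). *)
Lemma is_s_is_t_comm x z : is_s x -> is_t z -> x * z = z * x.
Proof.
move=> xS zT; rewrite -xS eps_sE sw_mulr sw_mull.
have e := sw_t' zT (f := fun c d => eps (x * d) *: c) ltac:(lin).
rewrite (sw_t zT) in e; last by lin.
rewrite (eq_sw (g := fun a b => eps (x * b) *: (a * z))) ?e => [|a b].
  by apply: eq_sw => a b; rewrite scalerAr.
by rewrite scalerAl.
Qed.

(** Contract the middle leg of Delta^2(1) with eps: the counit law gives Delta(1), the factorisation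
    gives eps_s(1_1) (x) 1_2. *)
Lemma sw1_s U (f : H -> H -> U) : bilin f ->
  \sw_(a, b <- 1) f (eps_s a) b = \sw_(a, b <- 1) f a b.
Proof.
move=> fL; transitivity (\sw_(a, b <- 1) \sw_(c, d <- a) eps d *: f c b).
  rewrite (sw1_12 HH (f := fun c d b => eps d *: f c b)); last by lin.
  apply: eq_sw => q r; rewrite eps_sE (lin_sw (g := f^~ r)); last by lin.
  by apply: eq_sw => a b; rewrite (lin_mapZ (f := f^~ r)) //; lin.
by apply: eq_sw => a b; rewrite (sw_counitr HH _ (f := f^~ b)) //; lin.
Qed.

Lemma sw1_t U (f : H -> H -> U) : bilin f ->
  \sw_(a, b <- 1) f a (eps_t b) = \sw_(a, b <- 1) f a b.
Proof.
move=> fL; transitivity (\sw_(a, b <- 1) \sw_(c, d <- a) eps d *: f c b).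
  rewrite (sw1_12 HH (f := fun c d b => eps d *: f c b)); last by lin.
  rewrite sw_exchange; apply: eq_sw => q r.
  rewrite eps_tE (lin_sw (g := f q)); last by lin.
  by apply: eq_sw => a b; rewrite (lin_mapZ (f := f q)) //; lin.
by apply: eq_sw => a b; rewrite (sw_counitr HH _ (f := f^~ b)) //; lin.
Qed.

(* The legs of Delta(1) may be assumed to lie in H_s and H_t. *)
Lemma eq_sw1 U (f g : H -> H -> U) : bilin f -> bilin g ->
  (forall a b, is_s a -> is_t b -> f a b = g a b) ->
  sw Delta 1 f = sw Delta 1 g.
Proof.
move=> fL gL fg.
rewrite -(sw1_s fL) -(sw1_s gL) -(sw1_t (f := fun a b => f (eps_s a) b)); last by lin.
rewrite -(sw1_t (f := fun a b => g (eps_s a) b)); last by lin.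
by apply: eq_sw => a b; apply: fg; [exact: is_s_eps_s | exact: is_t_eps_t].
Qed.

(** Write 1_1 h as 1_1 h_1 eps(1_2 h_2) and factor Delta^2(1): the unprimed legs merge back into
    Delta(h), and eps(1'_1 h_2) 1'_2 is eps_t(h_2). This trades an inner k_2 S(k_3) for legs of
    Delta(1). *)
Lemma sw_eps_t2 U h (f : H -> H -> U) : bilin f ->
  \sw_(a, b <- h) f a (eps_t b) = \sw_(a, b <- 1) f (a * h) b.
Proof.
move=> fL; symmetry.
transitivity (\sw_(a, b <- 1) \sw_(c, d <- a) \sw_(x, y <- h) eps (d * y) *: f (c * x) b).
  apply: eq_sw => a b; rewrite -(sw_counitr HH _ (f := f^~ b)); last by lin.
  by rewrite (swM HH) //; lin.
rewrite (sw1_12 HH (f := fun c d b => \sw_(x, y <- h) eps (d * y) *: f (c * x) b)); last by lin.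
transitivity (\sw_(q, r <- 1) \sw_(x, y <- h) eps (q * y) *: f x r).
  apply: eq_sw => q r; rewrite -[h in RHS]mul1r (swM HH); last by lin.
  by apply: eq_sw => a b; apply: eq_sw => x y; rewrite mulrA.
rewrite sw_exchange; apply: eq_sw => x y.
rewrite eps_tE (lin_sw (g := f x)); last by lin.
by apply: eq_sw => a b; rewrite (lin_mapZ (f := f x)) //; lin.
Qed.

Lemma sw_eps_s1 U h (f : H -> H -> U) : bilin f ->
  \sw_(a, b <- h) f (eps_s a) b = \sw_(a, b <- 1) f a (h * b).
Proof.
move=> fL; symmetry.
transitivity (\sw_(a, b <- 1) \sw_(c, d <- b) \sw_(x, y <- h) eps (x * c) *: f a (y * d)).
  apply: eq_sw => a b; rewrite -(sw_counitl HH _ (f := f a)); last by lin.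
  by rewrite (swM HH); [exact: sw_exchange | lin].
rewrite -(sw_coassoc HH _ (f := fun a c d => \sw_(x, y <- h) eps (x * c) *: f a (y * d))); last by lin.
rewrite (sw1_12 HH (f := fun a c d => \sw_(x, y <- h) eps (x * c) *: f a (y * d))); last by lin.
transitivity (\sw_(a, b <- 1) \sw_(x, y <- h) eps (x * b) *: f a y).
  rewrite sw_exchange; apply: eq_sw => a b.
  rewrite -[h in RHS]mulr1 (swM HH); last by lin.
  by rewrite sw_exchange; apply: eq_sw => x y; apply: eq_sw => q r; rewrite mulrA.
rewrite sw_exchange; apply: eq_sw => x y.
rewrite eps_sE (lin_sw (g := f^~ y)); last by lin.
by apply: eq_sw => a b; rewrite (lin_mapZ (f := f^~ y)) //; lin.
Qed.

End Bases.

(** * The antipode *)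

Section Antipode.
Variables (F : fieldType) (H : algType F) (Delta : H -> seq (H * H)).
Variables (eps : H -> F) (S : H -> H).
Hypothesis HH : is_weak_hopf_algebra Delta eps S.
Local Notation "\sw_ ( a , b <- h ) E" := (sw Delta h (fun a b => E))
  (at level 41, a name, b name, h at level 70, E at level 41,
   format "\sw_ ( a ,  b  <-  h )  E").
Local Notation eps_t := (eps_t Delta eps).
Local Notation eps_s := (eps_s Delta eps).
Local Notation is_t := (is_t Delta eps).
Local Notation is_s := (is_s Delta eps).
Implicit Types (U V W : lmodType F) (h k g : H).

Lemma S_eps_s h : \sw_(a, b <- h) eps_s a * S b = S h.
Proof.
have [_ [_ [_ _ _ e]]] := HH; rewrite [RHS]e; apply: eq_bigr => p _.
by rewrite -(S_convl HH) sw_mulr.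
Qed.

Lemma S_eps_t h : \sw_(a, b <- h) S a * eps_t b = S h.
Proof.
rewrite -S_eps_s; under eq_sw => a b do rewrite -(S_convr HH) sw_mull.
under [RHS]eq_sw => a b do rewrite -(S_convl HH) sw_mulr.
rewrite (sw_coassoc HH _ (f := fun a c d => S a * c * S d)); last by lin.
by apply: eq_sw => a b; apply: eq_sw => c d; rewrite mulrA.
Qed.

Lemma eps_t_mulT z h : is_t z -> eps_t (z * h) = z * eps_t h.
Proof.
move=> zT; rewrite -!(S_convr HH) (swtM HH _ zT); last by lin.
by rewrite sw_mull; apply: eq_sw => a b; rewrite mulrA.
Qed.

Lemma eps_s_mulS x h : is_s x -> eps_s (h * x) = eps_s h * x.
Proof.
move=> xS; rewrite -!(S_convl HH) (swMs HH _ xS); last by lin.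
by rewrite sw_mulr; apply: eq_sw => a b; rewrite mulrA.
Qed.

Lemma eps_t_conj z h : is_t z -> eps_t (h * z) = \sw_(a, b <- h) a * z * S b.
Proof. by move=> zT; rewrite -(S_convr HH) (swMt HH _ zT) //; lin. Qed.

Lemma eps_s_conj x h : is_s x -> eps_s (x * h) = \sw_(a, b <- h) S a * (x * b).
Proof. by move=> xS; rewrite -(S_convl HH) (swsM HH _ xS) //; lin. Qed.

(** S(z) = eps_s(z_1) S(z_2) = eps_s(z 1_1) S(1_2); since 1_1 is in H_s it leaves eps_s, and 1_1
    S(1_2) = 1. *)
Lemma S_is_t z : is_t z -> S z = eps_s z.
Proof.
move=> zT; rewrite -S_eps_s (sw_t' HH zT); last by lin.
rewrite (eq_sw1 HH (g := fun a b => eps_s z * (a * S b))); [|lin|lin|].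
  by rewrite -sw_mull (S_convr HH) (eps_t1 HH) mulr1.
by move=> a b aS _; rewrite eps_s_mulS // mulrA.
Qed.

Lemma S_is_s x : is_s x -> S x = eps_t x.
Proof.
move=> xS; rewrite -S_eps_t (sw_s' HH xS); last by lin.
rewrite (eq_sw1 HH (g := fun a b => S a * b * eps_t x)); [|lin|lin|].
  by rewrite -sw_mulr (S_convl HH) (eps_s1 HH) mul1r.
by move=> a b _ bT; rewrite eps_t_mulT // mulrA.
Qed.

Lemma is_s_S z : is_t z -> is_s (S z).
Proof. by move=> zT; rewrite S_is_t //; exact: (is_s_eps_s HH). Qed.

Lemma is_t_S x : is_s x -> is_t (S x).
Proof. by move=> xS; rewrite S_is_s //; exact: (is_t_eps_t HH). Qed.

(** Expanding S(hg) = S(h_1 g_1) eps_t(h_2 g_2) gives eps_s(h_1 g_1) S(g_2) S(h_2). Then eps_s(h_1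
    g_1) = S(g_1) eps_s(h_1) g_2, and commuting eps_s(h_1) past eps_t(g_2) separates the two
    antipodes. *)
Lemma SM h g : S (h * g) = S g * S h.
Proof.
have e1 : S (h * g) =
    \sw_(a, b <- h) \sw_(c, d <- g) eps_s (a * c) * (S d * S b).
  rewrite -S_eps_t (swM HH); last by lin.
  symmetry; transitivity (\sw_(a, b <- h) \sw_(x, y <- a) \sw_(c, d <- g)
      \sw_(u, v <- c) S (x * u) * (y * v) * (S d * S b)).
    apply: eq_sw => a b; rewrite sw_exchange; apply: eq_sw => c d.
    rewrite -(S_convl HH) (swM HH); last by lin.
    rewrite sw_mulr; apply: eq_sw => x y; by rewrite sw_mulr.
  rewrite (sw_coassoc HH _ (f := fun x y b => \sw_(c, d <- g)
      \sw_(u, v <- c) S (x * u) * (y * v) * (S d * S b))); last by lin.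
  apply: eq_sw => a b.
  transitivity (\sw_(x, y <- b) \sw_(c, d <- g)
      \sw_(u, v <- d) S (a * c) * (x * u) * (S v * S y)).
    apply: eq_sw => x y.
    by rewrite (sw_coassoc HH _ (f := fun u v d => S (a * u) * (x * v) * (S d * S y))) //; lin.
  rewrite sw_exchange; apply: eq_sw => c d.
  rewrite -(eps_tM HH) eps_t_conj ?sw_mull; last exact: (is_t_eps_t HH).
  apply: eq_sw => x y; rewrite -(S_convr HH) sw_mull sw_mulr sw_mull.
  by apply: eq_sw => u v; rewrite !mulrA.
rewrite e1 -(S_eps_s h) sw_mull; apply: eq_sw => a b.
rewrite -(S_eps_t g) sw_mulr.
transitivity (\sw_(c, d <- g) \sw_(u, v <- c) S u * (eps_s a * v) * (S d * S b)).
  apply: eq_sw => c d; rewrite -(eps_sM HH) eps_s_conj ?sw_mulr //.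
  exact: (is_s_eps_s HH).
rewrite (sw_coassoc HH _ (f := fun u v d => S u * (eps_s a * v) * (S d * S b))); last by lin.
apply: eq_sw => c d.
rewrite -mulrA [eps_t d * _]mulrA -(is_s_is_t_comm HH (is_s_eps_s HH a) (is_t_eps_t HH d)).
rewrite -(S_convr HH) sw_mull sw_mulr sw_mull; apply: eq_sw => u v.
by rewrite !mulrA.
Qed.

(** On the legs of Delta(1) the antipode is eps_s or eps_t. Expanding both over further copies of
    Delta(1), the sum of eps(u 1_1) eps(1_2 y) collapses to eps(u y). *)
Lemma sw1_S U (f : H -> H -> U) : bilin f ->
  \sw_(a, b <- 1) f (S b) (S a) = sw Delta 1 f.
Proof.
move=> fL; rewrite -(sw1_t HH fL).
rewrite (eq_sw1 HH (g := fun a b => f (eps_s b) (eps_t a))); [|lin|lin|]; last first.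
  by move=> a b aS bT; rewrite (S_is_s aS) (S_is_t bT).
transitivity (\sw_(a, b <- 1) \sw_(x, y <- 1) \sw_(u, v <- 1)
    eps (u * a) *: (eps (b * y) *: f x v)).
  apply: eq_sw => a b.
  rewrite [eps_s b]eps_sE (lin_sw (g := f^~ _)); last by lin.
  apply: eq_sw => x y; rewrite (lin_mapZ (f := f^~ _)); last by lin.
  rewrite eps_tE (lin_sw (g := f x)); last by lin.
  rewrite swZ; apply: eq_sw => u v; rewrite (lin_mapZ (f := f x)); last by lin.
  by rewrite !scalerA mulrC.
rewrite sw_exchange; apply: eq_sw => x y.
rewrite sw_exchange eps_tE (lin_sw (g := f x)); last by lin.
apply: eq_sw => u v; rewrite (lin_mapZ (f := f x)); last by lin.
exact: (eps_mul12 HH).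
Qed.

Lemma S_surj_t z : is_t z -> exists2 x, is_s x & S x = z.
Proof.
(* The witness comes from z = eps(1_1 z) 1_2 with Delta(1) rewritten as S(1_2) (x) S(1_1). *)
move=> zT; exists (\sw_(a, b <- 1) eps (S b * z) *: a).
  rewrite /is_s (lin_sw (g := eps_s)); last by lin.
  rewrite -[RHS](sw1_s HH (f := fun a b => eps (S b * z) *: a)); last by lin.
  by apply: eq_sw => a b; rewrite (lin_mapZ (f := eps_s)) //; lin.
rewrite (lin_sw (g := S)); last by lin.
rewrite -[RHS]zT eps_tE -(sw1_S (f := fun a b => eps (a * z) *: b)); last by lin.
by apply: eq_sw => a b; rewrite (lin_mapZ (f := S)) //; lin.
Qed.

Lemma S_surj_s x : is_s x -> exists2 z, is_t z & S z = x.
Proof.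
move=> xS; exists (\sw_(a, b <- 1) eps (x * S a) *: b).
  rewrite /is_t (lin_sw (g := eps_t)); last by lin.
  rewrite -[RHS](sw1_t HH (f := fun a b => eps (x * S a) *: b)); last by lin.
  by apply: eq_sw => a b; rewrite (lin_mapZ (f := eps_t)) //; lin.
rewrite (lin_sw (g := S)); last by lin.
rewrite -[RHS]xS eps_sE -(sw1_S (f := fun a b => eps (x * b) *: a)); last by lin.
by apply: eq_sw => a b; rewrite (lin_mapZ (f := S)) //; lin.
Qed.

(** For h = 1 both sides are x_1 (x) eps_t(x_2), computed in two ways; the general case follows by
    writing h as h 1. *)
Lemma sw_s_move U h x (f : H -> H -> U) : is_s x -> bilin f ->
  \sw_(a, b <- h) f (a * x) b = \sw_(a, b <- h) f a (b * S x).
Proof.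
move=> xS fL.
have e1 (g : H -> H -> U) : bilin g ->
    \sw_(a, b <- 1) g (a * x) b = \sw_(a, b <- 1) g a (b * S x).
  move=> gL; rewrite -(sw_eps_t2 HH x gL) (sw_s' HH xS); last by lin.
  apply: (eq_sw1 HH); [lin|lin|] => a b _ bT.
  by rewrite eps_t_mulT // S_is_s.
rewrite -[h]mulr1 !(swM HH); [|lin|lin]; apply: eq_sw => a b.
rewrite (eq_sw (g := fun c d => f (a * (c * x)) (b * d))); last first.
  by move=> c d; rewrite mulrA.
rewrite (e1 (fun c d => f (a * c) (b * d))); last by lin.
by apply: eq_sw => c d; rewrite mulrA.
Qed.

Lemma sw_t_move U h z (f : H -> H -> U) : is_t z -> bilin f ->
  \sw_(a, b <- h) f a (z * b) = \sw_(a, b <- h) f (S z * a) b.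
Proof.
move=> zT fL.
have e1 (g : H -> H -> U) : bilin g ->
    \sw_(a, b <- 1) g a (z * b) = \sw_(a, b <- 1) g (S z * a) b.
  move=> gL; rewrite -(sw_eps_s1 HH z gL) (sw_t' HH zT); last by lin.
  apply: (eq_sw1 HH); [lin|lin|] => a b aS _.
  by rewrite eps_s_mulS // S_is_t.
rewrite -[h]mul1r !(swM HH); [|lin|lin]; rewrite sw_exchange [RHS]sw_exchange.
apply: eq_sw => a b.
rewrite (eq_sw (g := fun c d => f (c * a) ((z * d) * b))); last first.
  by move=> c d; rewrite mulrA.
rewrite (e1 (fun c d => f (c * a) (d * b))); last by lin.
by apply: eq_sw => c d; rewrite mulrA.
Qed.

(** Apply Delta to S(h) = S(h_1) eps_t(h_2) and use Delta(eps_t(h)) = h_1 S(h_4) (x) h_2 S(h_3). The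
    left part closes up to Delta(eps_s(h_1)), which reduces to Delta(1) by absorbing eps_s into S;
    [sw1_S] finishes. *)
Lemma swS U h (f : H -> H -> U) : bilin f ->
  sw Delta (S h) f = \sw_(a, b <- h) f (S b) (S a).
Proof.
move=> fL.
transitivity (\sw_(a, b <- h) \sw_(c, d <- b) \sw_(x, y <- S a) \sw_(u, v <- c)
    \sw_(p, q <- d) f (x * (u * S q)) (y * (v * S p))).
  rewrite -{1}(S_eps_t h) (lin_sw (g := fun y => sw Delta y f)); last by lin.
  apply: eq_sw => a b; rewrite (swM HH) // [RHS]sw_exchange; apply: eq_sw => x y.
  rewrite (sw_t HH (is_t_eps_t HH b)); last by lin.
  transitivity (\sw_(w, q <- b) \sw_(m, n <- 1) f (x * (m * w * S q)) (y * n)).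
    rewrite sw_exchange; apply: eq_sw => m n.
    rewrite -(S_convr HH) sw_mull (lin_sw (g := fun t => f (x * t) (y * n))); last by lin.
    by apply: eq_sw => w q; rewrite !mulrA.
  transitivity (\sw_(w, q <- b) \sw_(u, e <- w) f (x * (u * S q)) (y * eps_t e)).
    apply: eq_sw => w q.
    by rewrite (sw_eps_t2 HH w (f := fun u e => f (x * (u * S q)) (y * e))) //; lin.
  rewrite (sw_coassoc HH _ (f := fun u e q => f (x * (u * S q)) (y * eps_t e))); last by lin.
  rewrite (sw_coassoc HH _ (f := fun u v d => \sw_(p, q <- d) f (x * (u * S q)) (y * (v * S p)))); last by lin.
  apply: eq_sw => u w.
  rewrite -(sw_coassoc HH _ (f := fun v p q => f (x * (u * S q)) (y * (v * S p)))); last by lin.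
  apply: eq_sw => e q; rewrite -(S_convr HH) sw_mull (lin_sw (g := f _)) //; lin.
rewrite -(sw_coassoc HH _ (f := fun a c d => \sw_(x, y <- S a) \sw_(u, v <- c)
    \sw_(p, q <- d) f (x * (u * S q)) (y * (v * S p)))); last by lin.
transitivity (\sw_(a, b <- h) \sw_(p, q <- b) \sw_(x, y <- 1)
    f (x * S q) (y * (eps_s a * S p))).
  apply: eq_sw => a b.
  transitivity (sw Delta (eps_s a)
      (fun x y => \sw_(p, q <- b) f (x * S q) (y * S p))).
    rewrite -(S_convl HH) (lin_sw (g := fun t => sw Delta t
      (fun x y => \sw_(p, q <- b) f (x * S q) (y * S p)))); last by lin.
    apply: eq_sw => a' c; rewrite (swM HH); last by lin.
    apply: eq_sw => x y; apply: eq_sw => u v; apply: eq_sw => p q.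
    by rewrite !mulrA.
  rewrite (sw_s' HH (is_s_eps_s HH a)); last by lin.
  rewrite sw_exchange; apply: eq_sw => p q; apply: eq_sw => x y.
  by rewrite mulrA.
rewrite -(sw_coassoc HH _ (f := fun a p q => \sw_(x, y <- 1)
    f (x * S q) (y * (eps_s a * S p)))); last by lin.
transitivity (\sw_(a, b <- h) \sw_(x, y <- 1) f (x * S b) (y * S a)).
  apply: eq_sw => a b; rewrite sw_exchange; apply: eq_sw => x y.
  by rewrite -(S_eps_s a) (lin_sw (g := fun t => f (x * S b) (y * t))) //; lin.
rewrite -[h in RHS]mulr1 (swM HH); last by lin.
apply: eq_sw => a b; rewrite -(sw1_S (f := fun x y => f (x * S b) (y * S a))); last by lin.
by apply: eq_sw => x y; rewrite !SM.
Qed.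

End Antipode.

(** * Partial representations and the partial action on A *)

Section PartialRepresentation.
Variables (F : fieldType) (H : algType F) (Delta : H -> seq (H * H)).
Variables (eps : H -> F) (S : H -> H).
Hypothesis HH : is_weak_hopf_algebra Delta eps S.
Variables (B : algType F) (pi : H -> B).
Hypothesis piL : lin_map pi.

Lemma EwL : lin_map (Ew Delta S pi).
Proof.
change (lin_map (fun h => sw Delta h (fun a b => pi a * pi (S b)))); lin.
Qed.

Lemma pactL1 a : lin_map (fun h => pact Delta S pi h a).
Proof.
change (lin_map (fun h => sw Delta h (fun x y => pi x * a * pi (S y)))); lin.
Qed.

Lemma pactL2 h : lin_map (pact Delta S pi h).
Proof.
change (lin_map (fun a => sw Delta h (fun x y => pi x * a * pi (S y)))); lin.
Qed.

(** The mirror images of the E_h. They commute with A, which is what lets [h] be moved past elements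
    of A. *)
Definition Et h : B := sw Delta h (fun a b => pi (S a) * pi b).

Lemma EtL : lin_map Et.
Proof. rewrite /Et; lin. Qed.
End PartialRepresentation.
#[local] Hint Extern 1 (lin_map (Ew _ _ _)) => (eapply EwL; eassumption) : lin.
#[local] Hint Extern 1 (lin_map (Et _ _ _)) => (eapply EtL; eassumption) : lin.
#[local] Hint Extern 1 (lin_map (pact _ _ _ _)) => (eapply pactL2; eassumption) : lin.
#[local] Hint Extern 1 (lin_map (fun z => pact _ _ _ z _)) => (eapply pactL1; eassumption) : lin.

Section PartialAction.
Variables (F : fieldType) (H : algType F) (Delta : H -> seq (H * H)).
Variables (eps : H -> F) (S : H -> H).
Hypothesis HH : is_weak_hopf_algebra Delta eps S.
Variables (B : algType F) (pi : H -> B).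
Hypothesis piL : lin_map pi.
Hypothesis piR : satisfies_Hpar_relations Delta S pi.
Local Notation "\sw_ ( a , b <- h ) E" := (sw Delta h (fun a b => E))
  (at level 41, a name, b name, h at level 70, E at level 41,
   format "\sw_ ( a ,  b  <-  h )  E").
Local Notation eps_t := (eps_t Delta eps).
Local Notation eps_s := (eps_s Delta eps).
Local Notation is_t := (is_t Delta eps).
Local Notation is_s := (is_s Delta eps).
Local Notation Ew := (Ew Delta S pi).
Local Notation Et := (Et Delta S pi).
Local Notation pact := (pact Delta S pi).
Local Notation Apar := (Apar Delta S pi).
Implicit Types h k g : H.

Lemma EwE h : Ew h = \sw_(x, y <- h) pi x * pi (S y). Proof. by []. Qed.
Lemma EtE h : Et h = \sw_(x, y <- h) pi (S x) * pi y. Proof. by []. Qed.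
Lemma pactE h a : pact h a = \sw_(x, y <- h) pi x * a * pi (S y). Proof. by []. Qed.

Lemma pi1 : pi 1 = 1. Proof. by case: piR. Qed.

Lemma pi_Ew h k : pi h * Ew k = \sw_(x, y <- k) pi (h * x) * pi (S y).
Proof.
have [_ [r _ _ _ _]] := piR; rewrite EwE sw_mull; apply: etrans (r h k).
by apply: eq_bigr => p _; rewrite mulrA.
Qed.

Lemma pi_Et h k : pi h * Et k = \sw_(x, y <- k) pi (h * S x) * pi y.
Proof.
have [_ [_ r _ _ _]] := piR; rewrite EtE sw_mull; apply: etrans (r h k).
by apply: eq_bigr => p _; rewrite mulrA.
Qed.

Lemma Ew_pi h k : Ew h * pi k = \sw_(x, y <- h) pi x * pi (S y * k).
Proof. by have [_ [_ _ r _ _]] := piR; rewrite EwE sw_mulr; exact: r. Qed.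

Lemma Et_pi h k : Et h * pi k = \sw_(x, y <- h) pi (S x) * pi (y * k).
Proof. by have [_ [_ _ _ r _]] := piR; rewrite EtE sw_mulr; exact: r. Qed.

Lemma sw_Ew_pi h : \sw_(x, y <- h) Ew x * pi y = pi h.
Proof.
have [_ [_ _ _ _ r]] := piR; rewrite [RHS]r; apply: eq_bigr => p _.
by rewrite EwE sw_mulr.
Qed.

Lemma sw_pi_Et h : \sw_(x, y <- h) pi x * Et y = pi h.
Proof.
rewrite -[RHS]sw_Ew_pi; symmetry.
under eq_sw => x y do rewrite EwE sw_mulr.
rewrite (sw_coassoc HH _ (f := fun u v y => pi u * pi (S v) * pi y)); last by lin.
apply: eq_sw => x y; rewrite EtE sw_mull; apply: eq_sw => u v.
by rewrite mulrA.
Qed.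

(** Since Delta(zh) = z h_1 (x) h_2, the first relation gives [z] E_h = E_{zh}; then expand [h] =
    E_{h_1}[h_2]. The case of H_s on the right uses [Et] in the same way. *)
Lemma pi_tM z h : is_t z -> pi (z * h) = pi z * pi h.
Proof.
move=> zT; rewrite -[LHS]sw_Ew_pi (swtM HH _ zT); last by lin.
rewrite -(sw_Ew_pi h) sw_mull; apply: eq_sw => x y.
by rewrite mulrA pi_Ew EwE (swtM HH _ zT) //; lin.
Qed.

Lemma pi_Ms h x : is_s x -> pi (h * x) = pi h * pi x.
Proof.
move=> xS; rewrite -[LHS]sw_pi_Et (swMs HH _ xS); last by lin.
rewrite -(sw_pi_Et h) sw_mulr; apply: eq_sw => u v.
by rewrite -mulrA Et_pi EtE (swMs HH _ xS) //; lin.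
Qed.

Lemma sw1_pi h : \sw_(x, y <- 1) pi (h * x) * pi (S y) = pi h.
Proof.
rewrite (eq_sw1 HH (g := fun x y => pi (h * (x * S y)))); [|lin|lin|]; last first.
  by move=> x y _ yT; rewrite mulrA [RHS]pi_Ms //; exact: (is_s_S HH).
rewrite -(lin_sw (g := fun y => pi (h * y))); last by lin.
by rewrite (S_convr HH) (eps_t1 HH) mulr1.
Qed.

(** By [sw1_pi] one has E_z = [z], so the relation for [h] E_z is the claim. *)
Lemma pi_Mt h z : is_t z -> pi (h * z) = pi h * pi z.
Proof.
move=> zT; have := pi_Ew h z.
rewrite EwE !(sw_t' HH zT); [|lin|lin]; rewrite sw1_pi => ->.
by rewrite -[LHS]sw1_pi; apply: eq_sw => x y; rewrite mulrA.
Qed.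

Lemma pi_sM x h : is_s x -> pi (x * h) = pi x * pi h.
Proof.
move=> xS; have := Et_pi x h.
have e g : \sw_(a, b <- 1) pi (S a) * pi (x * b * g) = pi (x * g).
  rewrite (eq_sw1 HH (g := fun a b => pi (x * (S a * b) * g))); [|lin|lin|].
    rewrite -(lin_sw (g := fun y => pi (x * y * g))); last by lin.
    by rewrite (S_convl HH) (eps_s1 HH) mulr1.
  move=> a b aS _; rewrite -pi_tM; last exact: (is_t_S HH).
  by rewrite !mulrA (is_s_is_t_comm HH xS (is_t_S HH aS)).
rewrite EtE !(sw_s HH xS); [|lin|lin]; rewrite e => <-; congr (_ * _).
by rewrite -[x in RHS]mulr1 -e; apply: eq_sw => a b; rewrite mulr1.
Qed.

(** Rebracketed as [S(h_1)] E_{h_2}, the sum becomes [eps_s(h_1)][S(h_2)], a product that merges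
    because eps_s(h_1) is in H_s. *)
Lemma sw_Et_piS h : \sw_(x, y <- h) Et x * pi (S y) = pi (S h).
Proof.
transitivity (\sw_(x, y <- h) pi (S x) * Ew y).
  under eq_sw => x y do rewrite EtE sw_mulr.
  rewrite (sw_coassoc HH _ (f := fun u v y => pi (S u) * pi v * pi (S y))); last by lin.
  apply: eq_sw => x y; rewrite EwE sw_mull; apply: eq_sw => u v.
  by rewrite mulrA.
under eq_sw => x y do rewrite pi_Ew.
rewrite -(sw_coassoc HH _ (f := fun x u v => pi (S x * u) * pi (S v))); last by lin.
rewrite -(S_eps_s HH h) (lin_sw (g := pi)) //; apply: eq_sw => x y.
rewrite pi_sM -?(S_convl HH) ?(lin_sw (g := pi)) ?sw_mulr //.
by rewrite (S_convl HH); exact: (is_s_eps_s HH).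
Qed.

Lemma piM h k : pi h * pi k = \sw_(x, y <- h) Ew x * pi (y * k).
Proof.
rewrite -{1}(sw_pi_Et h) sw_mulr.
under eq_sw => x y do rewrite -mulrA Et_pi sw_mull.
rewrite -(sw_coassoc HH _ (f := fun x u v => pi x * (pi (S u) * pi (v * k)))); last by lin.
apply: eq_sw => x y; rewrite EwE sw_mulr; apply: eq_sw => u v.
by rewrite mulrA.
Qed.

Lemma piMS h k : pi h * pi (S k) = \sw_(x, y <- k) pi (h * S x) * Ew y.
Proof.
rewrite -(sw_Et_piS k) sw_mull.
under eq_sw => x y do rewrite mulrA pi_Et sw_mulr.
rewrite (sw_coassoc HH _ (f := fun x u v => pi (h * S x) * pi u * pi (S v))); last by lin.
apply: eq_sw => x y; rewrite EwE sw_mull; apply: eq_sw => u v.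
by rewrite mulrA.
Qed.

(** Expanding [h k_1][S(k_2)] by [piM] gives E_{h_1 k_1}[h_2 eps_t(k_2)], and [sw_eps_t2] moves
    eps_t(k_2) into a copy of Delta(1) that h absorbs. *)
Lemma pi_mul_Ew h k : pi h * Ew k = \sw_(x, y <- h) Ew (x * k) * pi y.
Proof.
rewrite pi_Ew.
transitivity (\sw_(c, d <- k) \sw_(u, v <- c) \sw_(x, y <- h)
    Ew (x * u) * pi (y * v * S d)).
  apply: eq_sw => c d; rewrite piM (swM HH); last by lin.
  exact: sw_exchange.
rewrite (sw_coassoc HH _ (f := fun u v d => \sw_(x, y <- h)
    Ew (x * u) * pi (y * v * S d))); last by lin.
transitivity (\sw_(x, y <- h) \sw_(u, w <- k) Ew (x * u) * pi (y * eps_t w)).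
  rewrite [RHS]sw_exchange; apply: eq_sw => u w; rewrite sw_exchange; apply: eq_sw => x y.
  rewrite -(S_convr HH) (lin_sw (g := fun t => Ew (x * u) * pi (y * t))); last by lin.
  by apply: eq_sw => v d; rewrite mulrA.
transitivity (\sw_(x, y <- h) \sw_(m, n <- 1) Ew (x * m * k) * pi (y * n)).
  apply: eq_sw => x y.
  rewrite (sw_eps_t2 HH _ (f := fun u w => Ew (x * u) * pi (y * w))); last by lin.
  by apply: eq_sw => m n; rewrite mulrA.
by rewrite -[h in RHS]mulr1 (swM HH) //; lin.
Qed.

(** Both sides equal [k_1][S(h_1 k_2)][h_2]. On the left, [pi_mul_Ew] produces S(h_1) h_2 =
    eps_s(h_1), which is then absorbed through Delta(1). *)
Lemma Et_Ew_comm h k : Et h * Ew k = Ew k * Et h.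
Proof.
transitivity (\sw_(x, y <- h) \sw_(u, v <- k) pi u * pi (S (x * v)) * pi y); last first.
  rewrite [RHS]sw_mull; apply: eq_sw => x y; rewrite mulrA Ew_pi sw_mulr.
  by apply: eq_sw => u v; rewrite (SM HH).
pose K a p p' y := \sw_(q, q' <- k) pi (S a * (p * q)) * pi (S (p' * q')) * pi y.
transitivity (\sw_(a, b <- h) \sw_(x, y <- b) \sw_(p, p' <- x) K a p p' y).
  rewrite EtE sw_mulr; apply: eq_sw => a b; rewrite -mulrA pi_mul_Ew sw_mull.
  apply: eq_sw => x y; rewrite mulrA pi_Ew sw_mulr (swM HH) //; lin.
transitivity (\sw_(a, b <- h) \sw_(p, w <- b) \sw_(p', y <- w) K a p p' y).
  apply: eq_sw => a b; rewrite (sw_coassoc HH _ (f := K a)) // /K; lin.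
rewrite -(sw_coassoc HH _ (f := fun a p w => \sw_(p', y <- w) K a p p' y)); last by rewrite /K; lin.
pose f m w := \sw_(p', y <- w) \sw_(q, q' <- k) pi (m * q) * pi (S (p' * q')) * pi y.
transitivity (\sw_(b, w <- h) f (eps_s b) w).
  apply: eq_sw => b w; rewrite -(S_convl HH) (lin_sw (g := f^~ w)); last by rewrite /f; lin.
  apply: eq_sw => a p; apply: eq_sw => p' y; apply: eq_sw => q q'.
  by rewrite mulrA.
rewrite (sw_eps_s1 HH); last by rewrite /f; lin.
rewrite (eq_sw1 HH (g := fun m n => \sw_(p, y <- h) \sw_(q, q' <- k)
   pi (m * q) * pi (S (p * (n * q'))) * pi y)); [|rewrite /f; lin|lin|]; last first.
  move=> m n _ nT; rewrite /f (swMt HH _ nT); last by lin.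
  by apply: eq_sw => p y; apply: eq_sw => q q'; rewrite mulrA.
rewrite sw_exchange; apply: eq_sw => p y.
by rewrite -[k in RHS]mul1r (swM HH) //; lin.
Qed.

Lemma Apar_Et_comm a h : Apar a -> a * Et h = Et h * a.
Proof.
elim=> [k||x y _ IHx _ IHy|c x _ IHx|x y _ IHx _ IHy].
- by rewrite Et_Ew_comm.
- by rewrite mul1r mulr1.
- by rewrite mulrDl mulrDr IHx IHy.
- by rewrite -scalerAl -scalerAr IHx.
- by rewrite -mulrA IHy !mulrA IHx.
Qed.

(** On a generator write x = S(z) with z in H_t: then S(k_2) x = S(z k_2), and z moves to the first
    leg as S(z). *)
Lemma Apar_pi_s_comm a x : Apar a -> is_s x -> a * pi x = pi x * a.
Proof.
move=> Aa xS; elim: Aa => [k||y z _ IHy _ IHz|c y _ IHy|y z _ IHy _ IHz].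
- have [z zT <-] := S_surj_s HH xS; rewrite Ew_pi EwE sw_mull.
  rewrite (eq_sw (g := fun u v => pi u * pi (S (z * v)))); last first.
    by move=> u v; rewrite (SM HH).
  rewrite (sw_t_move HH _ (f := fun u v => pi u * pi (S v)) zT); last by lin.
  by apply: eq_sw => u v; rewrite pi_sM ?mulrA //; exact: (is_s_S HH).
- by rewrite mul1r mulr1.
- by rewrite mulrDl mulrDr IHy IHz.
- by rewrite -scalerAl -scalerAr IHy.
- by rewrite -mulrA IHz !mulrA IHy.
Qed.

Lemma Ew_s x : is_s x -> Ew x = pi (S x).
Proof.
move=> xS; rewrite EwE (sw_s HH xS); last by lin.
rewrite (eq_sw1 HH (g := fun u v => pi (1 * u) * pi (S v) * pi (S x))); [|lin|lin|].
  by rewrite -sw_mulr sw1_pi pi1 mul1r.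
move=> u v _ vT; rewrite (SM HH) pi_sM ?mul1r ?mulrA //; exact: (is_s_S HH).
Qed.

Lemma Apar_pi_t z : is_t z -> Apar (pi z).
Proof. by move=> /(S_surj_t HH) [x xS <-]; rewrite -Ew_s //; exact: Apar_E. Qed.

Lemma Apar0 : Apar 0.
Proof. by rewrite -(scale0r 1); apply: Apar_scale; exact: Apar_1. Qed.

Lemma Apar_sw h (f : H -> H -> B) : (forall x y, Apar (f x y)) -> Apar (sw Delta h f).
Proof.
move=> Af; rewrite /sw; elim: (Delta h) => [|p s IH]; rewrite ?big_nil ?big_cons.
  exact: Apar0.
exact: Apar_add.
Qed.

Lemma pact1 h : pact h 1 = Ew h.
Proof. by apply: eq_bigr => p _; rewrite mulr1. Qed.

(** Write [h] = [h_1] Et(h_2) and commute [Et] past a. This is the cross relation of the smash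
    product. *)
Lemma pi_mul_Apar h a : Apar a -> pi h * a = \sw_(x, y <- h) pact x a * pi y.
Proof.
move=> Aa; under eq_sw => x y do rewrite pactE sw_mulr.
rewrite (sw_coassoc HH _ (f := fun u v y => pi u * a * pi (S v) * pi y)); last by lin.
rewrite -{1}(sw_pi_Et h) sw_mulr; apply: eq_sw => x y.
rewrite -mulrA -Apar_Et_comm // mulrA EtE sw_mull; apply: eq_sw => u v.
by rewrite !mulrA.
Qed.

Lemma Apar_mul_piS h a : Apar a -> a * pi (S h) = \sw_(x, y <- h) pi (S x) * pact y a.
Proof.
move=> Aa; under eq_sw => x y do rewrite pactE sw_mull.
rewrite -(sw_coassoc HH _ (f := fun x u v => pi (S x) * (pi u * a * pi (S v)))); last by lin.
rewrite -{1}(sw_Et_piS h) sw_mull; apply: eq_sw => x y.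
rewrite mulrA Apar_Et_comm // EtE !sw_mulr; apply: eq_sw => u v.
by rewrite !mulrA.
Qed.

Lemma pactM h a b : Apar a -> pact h (a * b) = \sw_(x, y <- h) pact x a * pact y b.
Proof.
move=> Aa; under [RHS]eq_sw => x y do rewrite (pactE y) sw_mull.
rewrite -(sw_coassoc HH _ (f := fun x u v => pact x a * (pi u * b * pi (S v)))); last by lin.
rewrite pactE; apply: eq_sw => x y; rewrite mulrA pi_mul_Apar // !sw_mulr.
by apply: eq_sw => u v; rewrite !mulrA.
Qed.

Lemma pact_Ew_l h a : \sw_(x, y <- h) Ew x * pact y a = pact h a.
Proof.
rewrite -[a in RHS]mul1r pactM; last exact: Apar_1.
by apply: eq_sw => x y; rewrite pact1.
Qed.

Lemma pact_Ew_r h a : Apar a -> \sw_(x, y <- h) pact x a * Ew y = pact h a.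
Proof.
move=> Aa; rewrite -[a in RHS]mulr1 pactM //.
by apply: eq_sw => x y; rewrite pact1.
Qed.

Lemma pact_1 a : Apar a -> pact 1 a = a.
Proof.
move=> Aa; rewrite pactE (eq_sw1 HH (g := fun x y => a * (pi (1 * x) * pi (S y)))); [|lin|lin|].
  by rewrite -sw_mull sw1_pi pi1 mulr1.
by move=> x y xS _; rewrite mul1r mulrA (Apar_pi_s_comm Aa xS).
Qed.

Lemma pact_pi k a m : Apar a ->
  pact k a * pi m = \sw_(u, v <- k) pi u * a * pi (S v * m).
Proof.
move=> Aa; under eq_sw => u v do rewrite pi_mul_Apar // sw_mulr.
rewrite (sw_coassoc HH _ (f := fun x y v => pact x a * pi y * pi (S v * m))); last by lin.
rewrite -{1}(pact_Ew_r k Aa) sw_mulr; apply: eq_sw => x y.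
rewrite -mulrA Ew_pi sw_mull; apply: eq_sw => u v; by rewrite mulrA.
Qed.

Lemma pi_pact k a m : Apar a ->
  pi m * pact k a = \sw_(u, v <- k) pi (m * u) * a * pi (S v).
Proof.
move=> Aa; under eq_sw => u v do rewrite -mulrA Apar_mul_piS // sw_mull.
rewrite -(sw_coassoc HH _ (f := fun u x y => pi (m * u) * (pi (S x) * pact y a))); last by lin.
rewrite -{1}(pact_Ew_l k a) sw_mull; apply: eq_sw => x y.
rewrite mulrA pi_Ew sw_mulr; apply: eq_sw => u v; by rewrite mulrA.
Qed.

(** This is (PA3), as h . 1 = E_h; [pact_pactr] is the symmetric (PA4). The trailing antipode is
    absorbed by [pact_pi], and [h_1][k_1] is opened by [piM]. *)
Lemma pact_pactl h k a : Apar a ->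
  pact h (pact k a) = \sw_(x, y <- h) Ew x * pact (y * k) a.
Proof.
move=> Aa.
transitivity (\sw_(x, y <- h) \sw_(q, r <- y) \sw_(u, v <- k)
    Ew x * pi (q * u) * a * pi (S v * S r)); last first.
  apply: eq_sw => x y; rewrite pactE (swM HH) ?sw_mull; last by lin.
  apply: eq_sw => q r; rewrite sw_mull; apply: eq_sw => u v.
  by rewrite (SM HH) !mulrA.
rewrite -(sw_coassoc HH _ (f := fun x q r => \sw_(u, v <- k)
    Ew x * pi (q * u) * a * pi (S v * S r))); last by lin.
rewrite pactE; apply: eq_sw => x y; rewrite -mulrA pact_pi // sw_exchange sw_mull.
apply: eq_sw => u v; rewrite !mulrA piM !sw_mulr; by apply: eq_sw.
Qed.

Lemma pact_pactr h k a : Apar a ->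
  pact h (pact k a) = \sw_(x, y <- h) pact (x * k) a * Ew y.
Proof.
move=> Aa.
transitivity (\sw_(x, y <- h) \sw_(q, r <- x) \sw_(u, v <- k)
    pi (q * u) * a * (pi (S v * S r) * Ew y)); last first.
  apply: eq_sw => x y; rewrite (pactE (x * k)) (swM HH) ?sw_mulr; last by lin.
  apply: eq_sw => q r; rewrite sw_mulr; apply: eq_sw => u v.
  by rewrite (SM HH) !mulrA.
rewrite (sw_coassoc HH _ (f := fun q r y => \sw_(u, v <- k)
    pi (q * u) * a * (pi (S v * S r) * Ew y))); last by lin.
rewrite pactE; apply: eq_sw => x y; rewrite pi_pact // sw_exchange sw_mulr.
by apply: eq_sw => u v; rewrite -mulrA piMS sw_mull.
Qed.

Lemma Apar_pact h a : Apar a -> Apar (pact h a).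
Proof.
move=> Aa; elim: Aa h => [k||x y Ax IHx Ay IHy|c x Ax IHx|x y Ax IHx Ay IHy] h.
(* Reading E_k as k . 1, (PA3) turns h . E_k into products E_{h_1} E_{h_2 k} of generators. *)
- rewrite -pact1 pact_pactl; last exact: Apar_1.
  by apply: Apar_sw => x y; rewrite pact1; apply: Apar_mul; exact: Apar_E.
- by rewrite pact1; exact: Apar_E.
- by rewrite (lin_mapD (f := pact h)); [exact: Apar_add | lin].
- by rewrite (lin_mapZ (f := pact h)); [exact: Apar_scale | lin].
- by rewrite pactM //; apply: Apar_sw => u v; exact: Apar_mul.
Qed.

Lemma pact_Mt h z a : is_t z -> pact (h * z) a = pact h (pi z * a).
Proof.
move=> zT; rewrite !pactE (swMt HH _ zT); last by lin.
by apply: eq_sw => x y; rewrite pi_Mt // !mulrA.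
Qed.

Lemma pact_tM h z a : is_t z -> pact (z * h) a = pi z * pact h a.
Proof.
move=> zT; rewrite !pactE (swtM HH _ zT) ?sw_mull; last by lin.
by apply: eq_sw => x y; rewrite pi_tM // !mulrA.
Qed.

Lemma pact_Ms h x a : is_s x -> pact (h * x) a = pact h (a * pi (S x)).
Proof.
move=> xS; rewrite !pactE (swMs HH _ xS); last by lin.
by apply: eq_sw => u v; rewrite (SM HH) pi_tM ?mulrA //; exact: (is_t_S HH).
Qed.

Lemma pact_sM h x a : is_s x -> pact (x * h) a = pact h a * pi (S x).
Proof.
move=> xS; rewrite !pactE (swsM HH _ xS) ?sw_mulr; last by lin.
by apply: eq_sw => u v; rewrite (SM HH) pi_Mt ?mulrA //; exact: (is_t_S HH).
Qed.

Lemma pact_s x a : is_s x -> Apar a -> pact x a = a * pi (S x).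
Proof. by move=> xS Aa; rewrite -[x]mulr1 pact_sM // pact_1 // mulr1. Qed.

Lemma sw_Ew_pi_eps_t h : \sw_(x, y <- h) Ew x * pi (eps_t y) = Ew h.
Proof.
under eq_sw => x y do rewrite -(S_convr HH) (lin_sw (g := pi)) // sw_mull.
rewrite -(sw_coassoc HH _ (f := fun x u v => Ew x * pi (u * S v))); last by lin.
by rewrite EwE; apply: eq_sw => x y; rewrite piM.
Qed.

End PartialAction.

(** * Balanced maps *)

Section BalancedRules.
Variables (F : fieldType) (H : algType F) (Delta : H -> seq (H * H)).
Variables (eps : H -> F) (S : H -> H) (Sinv : H -> H).
Variables (B : algType F) (pi : H -> B).
Variables (U V : lmodType F) (f : B -> H -> U).
Hypothesis fB : balanced Delta eps S pi Sinv f.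

Lemma balanced_lin1 (g : V -> B) k : lin_map g ->
  (forall x, Apar Delta S pi (g x)) -> lin_map (fun x => f (g x) k).
Proof. by case: fB => fL _ _ gL gA c x y; rewrite gL fL. Qed.

Lemma balanced_lin2 (g : V -> H) a : Apar Delta S pi a -> lin_map g ->
  lin_map (fun x => f a (g x)).
Proof. by case: fB => _ fL _ Aa gL c x y; rewrite gL fL. Qed.

Lemma balanced0 k : f 0 k = 0.
Proof.
case: fB => fL _ _; have A0 := Apar0 Delta S pi.
by have := fL (-1) 0 0 k A0 A0; rewrite scaler0 addr0 scaleN1r addNr.
Qed.

Lemma balancedZ c a k : Apar Delta S pi a -> f (c *: a) k = c *: f a k.
Proof.
case: fB => fL _ _ Aa; have := fL c a 0 k Aa (Apar0 Delta S pi).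
by rewrite balanced0 !addr0.
Qed.

Lemma balanced_sum (I : Type) (s : seq I) (g : I -> B) k :
  (forall i, Apar Delta S pi (g i)) ->
  f (\sum_(i <- s) g i) k = \sum_(i <- s) f (g i) k.
Proof.
case: fB => fL _ _ gA.
elim: s => [|i s IH]; first by rewrite !big_nil balanced0.
have As : Apar Delta S pi (\sum_(i <- s) g i).
  elim: (s) => [|j t IHt]; rewrite ?big_nil ?big_cons; first exact: Apar0.
  exact: Apar_add.
by rewrite !big_cons -IH -[g i]scale1r fL // !scale1r.
Qed.

Lemma balanced_sw h (g : H -> H -> B) k :
  (forall x y, Apar Delta S pi (g x y)) ->
  f (sw Delta h g) k = sw Delta h (fun x y => f (g x y) k).
Proof. by move=> gA; exact: balanced_sum. Qed.
End BalancedRules.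

(** Balanced maps are constrained on A alone, so their linearity rules carry membership goals;
    [apar] closes these. *)
Ltac apar :=
  intros;
  first
    [ eassumption
    | apply: Apar_1
    | apply: Apar_E
    | apply: Apar_mul; apar
    | eapply Apar_pact; [eassumption | eassumption | eassumption | apar]
    | eapply Apar_pi_t; [eassumption | eassumption | eassumption |
        first [eassumption | eapply is_t_eps_t; eassumption]]
    | apply: Apar_sw; apar ].

Ltac lin_extra ::=
  match goal with
  | K : balanced _ _ _ _ _ ?f |- lin_map (fun x => ?f ?a (@?g x)) =>
      apply: (@balanced_lin2 _ _ _ _ _ _ _ _ _ _ _ K g a); [apar | lin]
  | K : balanced _ _ _ _ _ ?f |- lin_map (fun x => ?f (@?g x) ?k) =>
      apply: (@balanced_lin1 _ _ _ _ _ _ _ _ _ _ _ K g k); [lin | apar]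
  | K : balanced _ _ _ _ _ ?f |- lin_map (?f ?a) =>
      apply: (@balanced_lin2 _ _ _ _ _ _ _ _ _ _ _ K id a); [apar | lin]
  end.

(** * Left multiplication operators on balanced maps *)

Section Operators.
Variables (F : fieldType) (H : algType F) (Delta : H -> seq (H * H)).
Variables (eps : H -> F) (S : H -> H) (Sinv : H -> H).
Hypothesis HH : is_weak_hopf_algebra Delta eps S.
Hypotheses (HS1 : cancel S Sinv) (HS2 : cancel Sinv S).
Variables (B : algType F) (pi : H -> B).
Hypothesis piL : lin_map pi.
Hypothesis piR : satisfies_Hpar_relations Delta S pi.
Local Notation "\sw_ ( a , b <- h ) E" := (sw Delta h (fun a b => E))
  (at level 41, a name, b name, h at level 70, E at level 41,
   format "\sw_ ( a ,  b  <-  h )  E").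
Local Notation eps_t := (eps_t Delta eps).
Local Notation eps_s := (eps_s Delta eps).
Local Notation is_t := (is_t Delta eps).
Local Notation is_s := (is_s Delta eps).
Local Notation Ew := (Ew Delta S pi).
Local Notation Et := (Et Delta S pi).
Local Notation pact := (pact Delta S pi).
Local Notation Apar := (Apar Delta S pi).
Local Notation balanced := (balanced Delta eps S pi Sinv).
Local Notation rtri := (rtri Delta S pi Sinv).
Implicit Types (U : lmodType F) (h k g m : H).

Lemma in_Ht_is_t z : in_Ht Delta eps z <-> is_t z.
Proof. by split=> [[h ->]|<-]; [exact: (is_t_eps_t HH) | exists z]. Qed.

Lemma Sinv_t z : is_t z -> is_s (Sinv z).
Proof. by move=> /(S_surj_t HH) [x xS <-]; rewrite HS1. Qed.

(** S^{-1}(z) lies in H_s, where E_x = [S(x)]. Balancing thus becomes f(a [z], m) = f(a, z m). *)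
Lemma rtriE a z : is_t z -> rtri a z = a * pi z.
Proof.
move=> zT; rewrite /Defs.rtri pact1 (Ew_s HH piL piR) ?HS2 //; exact: Sinv_t.
Qed.

(* [lmul h f] is the functional f precomposed with left multiplication by
   1 # h in the smash product. *)
Definition lmul U h (f : B -> H -> U) : B -> H -> U :=
  fun a m => \sw_(x, y <- h) f (pact x a) (y * m).

Definition lmulA U e (f : B -> H -> U) : B -> H -> U := fun a m => f (e * a) m.

Section Balanced.
Variables (U : lmodType F).
Implicit Type f : B -> H -> U.

Lemma balanced_t f a z m : balanced f -> Apar a -> is_t z ->
  f (a * pi z) m = f a (z * m).
Proof.
by move=> [_ _ fT] Aa zT; rewrite -fT // ?rtriE //; apply/in_Ht_is_t.
Qed.

(** With x = S^{-1}(z) in H_s, h_1 . (a [z]) is (h_1 x) . a, and moving x to the second leg turns it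
    into S(x) = z. *)
Lemma balanced_lmul h f : balanced f -> balanced (lmul h f).
Proof.
move=> fB; split=> [c a a' m Aa Aa'|c a m m' Aa|a z m Aa /in_Ht_is_t zT].
- rewrite /lmul swZ /sw -big_split; apply: eq_bigr => p _ /=.
  rewrite (pactL2 Delta S pi); case: fB => -> //; apar.
- have : lin_map (lmul h f a) by rewrite /lmul; lin.
  by apply.
rewrite rtriE // /lmul -(HS2 z).
have xS := Sinv_t zT; set x := Sinv z in xS *.
rewrite (eq_sw (g := fun u v => f (pact (u * x) a) (v * m))); last first.
  by move=> u v; rewrite (pact_Ms HH).
rewrite (sw_s_move HH _ (f := fun u v => f (pact u a) (v * m)) xS); last by lin.
by apply: eq_sw => u v; rewrite mulrA.
Qed.

Lemma balanced_lmulA e f : Apar e -> balanced f -> balanced (lmulA e f).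
Proof.
move=> Ae [fL1 fL2 fT]; split=> [c a a' m Aa Aa'|c a m m' Aa|a z m Aa zT].
- by rewrite /lmulA mulrDr -scalerAr fL1 //; apar.
- by rewrite /lmulA fL2 //; apar.
- by rewrite /lmulA -fT ?/Defs.rtri ?mulrA //; apar.
Qed.

(** Balancing carries 1_2, which is in H_t, into the first argument, where (1_1 . a)[1_2] = [1]
    a. *)
Lemma lmul1 f a m : balanced f -> Apar a -> lmul 1 f a m = f a m.
Proof.
move=> fB Aa; rewrite /lmul.
rewrite (eq_sw1 HH (g := fun x y => f (pact x a * pi (eps_t y)) m)); [|lin|lin|].
  rewrite -(balanced_sw fB); last by apar.
  rewrite (sw1_t HH (f := fun x y => pact x a * pi y)); last by lin.
  by rewrite -(pi_mul_Apar HH) // (pi1 piR) mul1r.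
by move=> x y xS yT; rewrite yT (balanced_t _ fB) //; apar.
Qed.

Lemma lmul_lmul f h k a m : balanced f -> Apar a ->
  lmul k (lmul h f) a m = \sw_(x, y <- h) lmul (y * k) (lmulA (Ew x) f) a m.
Proof.
move=> fB Aa.
transitivity (\sw_(x, y <- h) \sw_(p, q <- y) \sw_(u, v <- k)
    f (Ew x * pact (p * u) a) (q * v * m)); last first.
  by apply: eq_sw => x y; rewrite /lmul /lmulA (swM HH) //; lin.
rewrite -(sw_coassoc HH _ (f := fun x p q => \sw_(u, v <- k)
    f (Ew x * pact (p * u) a) (q * v * m))); last by lin.
rewrite /lmul sw_exchange; apply: eq_sw => w q; rewrite sw_exchange.
apply: eq_sw => u v; rewrite (pact_pactl HH) // (balanced_sw fB) ?mulrA //; apar.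
Qed.

Lemma lmulL f a m : balanced f -> Apar a -> lin_map (fun h => lmul h f a m).
Proof. by move=> fB Aa; rewrite /lmul; lin. Qed.

Lemma lmul_lin h c f f1 f2 a m :
  (forall a m, f a m = c *: f1 a m + f2 a m) ->
  lmul h f a m = c *: lmul h f1 a m + lmul h f2 a m.
Proof.
by move=> ff; rewrite /lmul swZ /sw -big_split; apply: eq_bigr => p _; exact: ff.
Qed.

Lemma lmul_tM f z k a m : balanced f -> Apar a -> is_t z ->
  lmul (z * k) f a m = lmul k (lmulA (pi z) f) a m.
Proof.
move=> fB Aa zT; rewrite /lmul (swtM HH _ zT); last by lin.
by apply: eq_sw => x y; rewrite (pact_tM HH).
Qed.

(** Operator form of [h_1][S(h_2) k] = E_h [k]: after [lmul_lmul] the antipode meets its leg as h_2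
    S(h_3) = eps_t(h_2), and E_{h_1}[eps_t(h_2)] = E_h. *)
Lemma lmul_S f h k a m : balanced f -> Apar a ->
  \sw_(x, y <- h) lmul (S y * k) (lmul x f) a m = lmul k (lmulA (Ew h) f) a m.
Proof.
move=> fB Aa.
transitivity (\sw_(x, y <- h) \sw_(u, v <- x)
    lmul (v * (S y * k)) (lmulA (Ew u) f) a m).
  by apply: eq_sw => x y; rewrite lmul_lmul.
rewrite /lmul /lmulA (sw_coassoc HH _ (f := fun u v y => 
    \sw_(p, q <- v * (S y * k)) f (Ew u * pact p a) (q * m))); last by lin.
transitivity (\sw_(u, w <- h) \sw_(p, q <- k) f (Ew u * pi (eps_t w) * pact p a) (q * m)).
  apply: eq_sw => u w; have AE : Apar (Ew u) by apar.
  have := lmul_tM k m (balanced_lmulA AE fB) Aa (is_t_eps_t HH w).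
  rewrite /lmul /lmulA => e.
  transitivity (\sw_(p, q <- eps_t w * k) f (Ew u * pact p a) (q * m)); last first.
    by rewrite e; apply: eq_sw => p q; rewrite mulrA.
  rewrite -(S_convr HH) sw_mulr (lin_sw (g := fun t => 
     \sw_(p, q <- t) f (Ew u * pact p a) (q * m))); last by lin.
  by apply: eq_sw => v y; rewrite mulrA.
rewrite sw_exchange; apply: eq_sw => p q.
rewrite -(balanced_sw fB); last by apar.
by rewrite -sw_mulr (sw_Ew_pi_eps_t HH).
Qed.

Lemma lmul_S1 f h a m : balanced f -> Apar a ->
  \sw_(x, y <- h) lmul (S y) (lmul x f) a m = f (Ew h * a) m.
Proof.
move=> fB Aa; have := lmul_S h 1 m fB Aa.
rewrite lmul1 //; last by apply: balanced_lmulA => //; apar.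
by move=> e; apply: etrans e; apply: eq_sw => x y; rewrite mulr1.
Qed.

Lemma lmul_rel3 f h k a m : balanced f -> Apar a ->
  \sw_(x, y <- h) lmul k (lmul (S y) (lmul x f)) a m =
  \sw_(x, y <- h) lmul (S y * k) (lmul x f) a m.
Proof.
move=> fB Aa; rewrite lmul_S // [in LHS]/lmul sw_exchange; apply: eq_sw => p q.
by apply: lmul_S1 => //; apar.
Qed.

Lemma lmul_rel5 f h a m : balanced f -> Apar a ->
  \sw_(x, y <- h) \sw_(u, v <- x) lmul y (lmul (S v) (lmul u f)) a m = lmul h f a m.
Proof.
move=> fB Aa.
transitivity (\sw_(x, y <- h) \sw_(p, q <- y) f (Ew x * pact p a) (q * m)).
  apply: eq_sw => x y; rewrite [in LHS]/lmul sw_exchange; apply: eq_sw => p q.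
  by apply: lmul_S1 => //; apar.
rewrite -(sw_coassoc HH _ (f := fun x p q => f (Ew x * pact p a) (q * m))); last by lin.
apply: eq_sw => x y; rewrite -(balanced_sw fB); last by apar.
by rewrite (pact_Ew_l HH).
Qed.

(** E_k is opened as E_{k_1}[eps_t(k_2)] to match the factor k_2 S(k_3) on the other side of the
    first relation. *)
Lemma pact_Ew_mul h k a : Apar a -> pact h (Ew k * a) =
  \sw_(p, s <- h) \sw_(u, w <- k) Ew (p * u) * pact (s * eps_t w) a.
Proof.
move=> Aa; rewrite -(sw_Ew_pi_eps_t HH) // sw_mulr (lin_sw (g := pact h)); last by lin.
rewrite [RHS]sw_exchange; apply: eq_sw => u w.
rewrite -mulrA (pactM HH) //; last by apar.
transitivity (\sw_(p, s <- h) \sw_(c, d <- p)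
    Ew (c * u) * Ew d * pact s (pi (eps_t w) * a)).
  apply: eq_sw => p s; rewrite -(pact1 _ _ _ u) (pact_pactr HH) ?sw_mulr //; last by apar.
  by apply: eq_sw => c d; rewrite pact1.
rewrite (sw_coassoc HH _ (f := fun c d s =>
    Ew (c * u) * Ew d * pact s (pi (eps_t w) * a))); last by lin.
apply: eq_sw => c e; rewrite (pact_Mt HH) //; last exact: (is_t_eps_t HH).
rewrite -(pact_Ew_l HH _ _ e) // sw_mull; apply: eq_sw => d s; by rewrite mulrA.
Qed.

Lemma lmul_rel1 f h k a m : balanced f -> Apar a ->
  \sw_(x, y <- k) lmul (S y) (lmul x (lmul h f)) a m =
  \sw_(x, y <- k) lmul (S y) (lmul (h * x) f) a m.
Proof.
move=> fB Aa; rewrite lmul_S1 //; last exact: balanced_lmul.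
transitivity (\sw_(x, y <- k) \sw_(u, v <- x) \sw_(p, q <- h)
    \sw_(s, t <- q * v * S y) f (Ew (p * u) * pact s a) (t * m)); last first.
  apply: eq_sw => x y; rewrite lmul_lmul // (swM HH) ?/lmul ?/lmulA; last by lin.
  exact: sw_exchange.
rewrite (sw_coassoc HH _ (f := fun u v y => \sw_(p, q <- h)
    \sw_(s, t <- q * v * S y) f (Ew (p * u) * pact s a) (t * m))); last by lin.
transitivity (\sw_(u, w <- k) \sw_(p, q <- h) \sw_(s, t <- q)
     f (Ew (p * u) * pact (s * eps_t w) a) (t * m)); last first.
  apply: eq_sw => u w; rewrite [RHS]sw_exchange; apply: eq_sw => p q.
  rewrite -(swMt HH _ (f := fun s t => f (Ew (p * u) * pact s a) (t * m)) (is_t_eps_t HH w)); last by lin.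
  rewrite -(S_convr HH) sw_mull (lin_sw (g := fun x =>
    \sw_(s, t <- x) f (Ew (p * u) * pact s a) (t * m))); last by lin.
  by apply: eq_sw => v y; rewrite mulrA.
rewrite sw_exchange.
transitivity (\sw_(r, t <- h) \sw_(p, s <- r) \sw_(u, w <- k)
     f (Ew (p * u) * pact (s * eps_t w) a) (t * m)).
  apply: eq_sw => r t; rewrite pact_Ew_mul // (balanced_sw fB); last by apar.
  by apply: eq_sw => p s; rewrite (balanced_sw fB) //; apar.
rewrite (sw_coassoc HH _ (f := fun p s t => \sw_(u, w <- k)
     f (Ew (p * u) * pact (s * eps_t w) a) (t * m))); last by lin.
by apply: eq_sw => p q; exact: sw_exchange.
Qed.

(** Puts the two middle legs in one Sweedler pair, where S(d) and u act consecutively on a. *)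
Lemma sw_regroup4 k (K : H -> H -> H -> H -> U) :
  trilin (fun c d y => \sw_(u, v <- y) K c d u v) -> (forall c, trilin (K c)) ->
  \sw_(x, y <- k) \sw_(c, d <- x) \sw_(u, v <- y) K c d u v =
  \sw_(c, w <- k) \sw_(e, v <- w) \sw_(d, u <- e) K c d u v.
Proof.
move=> K1 K2; rewrite (sw_coassoc HH _ K1); apply: eq_sw => c w.
by rewrite (sw_coassoc HH _ (K2 c)).
Qed.

(** (PA4) together with the reversed coproduct of S brings S(e_2) next to e_3, leaving eps_s(e_2).
    Being in H_s, that element acts by right multiplication, which settles [pact_rel2] and
    [pact_rel4]. *)
Lemma pact_S_pact e k a : Apar a ->
  \sw_(d, u <- e) pact (S d) (pact (u * k) a) =
  \sw_(c, w <- e) pact (eps_s w * k) a * Ew (S c).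
Proof.
move=> Aa.
transitivity (\sw_(d, u <- e) \sw_(c, c' <- d) pact (S c' * (u * k)) a * Ew (S c)).
  apply: eq_sw => d u; rewrite (pact_pactr HH) // (swS HH) //; lin.
rewrite (sw_coassoc HH _ (f := fun c c' u => pact (S c' * (u * k)) a * Ew (S c))); last by lin.
apply: eq_sw => c w.
rewrite -(S_convl HH) sw_mulr (lin_sw (g := fun t => pact t a * Ew (S c))); last by lin.
by apply: eq_sw => c' u; rewrite mulrA.
Qed.

Lemma pact_rel4 e s a : Apar a ->
  \sw_(d, u <- e) pact (S d) (pact u (pact s a)) =
  \sw_(d, u <- e) pact (S d) (pact (u * s) a).
Proof.
move=> Aa; rewrite pact_S_pact //.
rewrite (eq_sw (g := fun d u => pact (S d) (pact (u * 1) (pact s a)))); last first.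
  by move=> d u; rewrite mulr1.
rewrite pact_S_pact; last by apar.
apply: eq_sw => c w; have wS := is_s_eps_s HH w.
by rewrite mulr1 (pact_sM HH) // (pact_s HH) //; apar.
Qed.

Lemma pact_rel2 e s a : Apar a ->
  \sw_(d, u <- e) pact s (pact (S d) (pact u a)) =
  \sw_(d, u <- e) pact (s * S d) (pact u a).
Proof.
move=> Aa; transitivity (\sw_(c, w <- e) \sw_(r, q <- s)
    pact (r * eps_s w) a * Ew (q * S c)).
  rewrite -(lin_sw (g := pact s)); last by lin.
  rewrite (eq_sw (g := fun d u => pact (S d) (pact (u * 1) a))); last first.
    by move=> d u; rewrite mulr1.
  rewrite pact_S_pact // (lin_sw (g := pact s)); last by lin.
  apply: eq_sw => c w; have wS := is_s_eps_s HH w.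
  have Aaw : Apar (a * pi (S (eps_s w))).
    by apply: Apar_mul => //; apply: (Apar_pi_t HH piL piR); exact: (is_t_S HH).
  rewrite mulr1 [pact (eps_s w) a](pact_s HH) // (pactM HH) //.
  transitivity (\sw_(p, q <- s) \sw_(q1, q2 <- q)
      pact p (a * pi (S (eps_s w))) * Ew q1 * Ew (q2 * S c)).
    apply: eq_sw => p q; rewrite -(pact1 _ _ _ (S c)) (pact_pactl HH) ?sw_mull //; last by apar.
    by apply: eq_sw => q1 q2; rewrite pact1 mulrA.
  rewrite -(sw_coassoc HH _ (f := fun p q1 q2 =>
      pact p (a * pi (S (eps_s w))) * Ew q1 * Ew (q2 * S c))); last by lin.
  apply: eq_sw => r q; rewrite -sw_mulr (pact_Ew_r HH) //.
  by rewrite (pact_Ms HH).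
transitivity (\sw_(d, u <- e) \sw_(c, c' <- d) \sw_(r, q <- s)
    pact (r * S c' * u) a * Ew (q * S c)); last first.
  apply: eq_sw => d u; rewrite (pact_pactr HH) // (swM HH); last by lin.
  rewrite [LHS]sw_exchange; apply: eq_sw => r q.
  by rewrite (swS HH) //; lin.
rewrite (sw_coassoc HH _ (f := fun c c' u => \sw_(r, q <- s)
    pact (r * S c' * u) a * Ew (q * S c))); last by lin.
apply: eq_sw => c w; rewrite [RHS]sw_exchange; apply: eq_sw => r q.
rewrite -(S_convl HH) sw_mull (lin_sw (g := fun t => pact t a * Ew (q * S c))); last by lin.
by apply: eq_sw => c' u; rewrite mulrA.
Qed.

Lemma lmul_rel2 f h k a m : balanced f -> Apar a ->
  \sw_(x, y <- k) lmul y (lmul (S x) (lmul h f)) a m =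
  \sw_(x, y <- k) lmul y (lmul (h * S x) f) a m.
Proof.
move=> fB Aa.
transitivity (\sw_(x, y <- k) \sw_(c, d <- x) \sw_(u, v <- y) \sw_(s, t <- h)
    f (pact s (pact (S d) (pact u a))) (t * (S c * (v * m)))).
  apply: eq_sw => x y; rewrite /lmul [RHS]sw_exchange; apply: eq_sw => u v.
  by rewrite (swS HH) //; lin.
transitivity (\sw_(x, y <- k) \sw_(c, d <- x) \sw_(u, v <- y) \sw_(s, t <- h)
    f (pact (s * S d) (pact u a)) (t * (S c * (v * m)))); last first.
  apply: eq_sw => x y; rewrite /lmul sw_exchange; apply: eq_sw => u v.
  rewrite (swM HH); last by lin.
  rewrite [LHS]sw_exchange; apply: eq_sw => s t.
  by rewrite (swS HH); [apply: eq_sw => c d; rewrite !mulrA | lin].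
rewrite !sw_regroup4; [|lin|move=> ?; lin|lin|move=> ?; lin].
apply: eq_sw => c w; apply: eq_sw => e v.
rewrite sw_exchange [RHS]sw_exchange; apply: eq_sw => s t.
rewrite -!(balanced_sw fB); [|apar|apar].
by rewrite pact_rel2.
Qed.

Lemma lmul_rel4 f h k a m : balanced f -> Apar a ->
  \sw_(x, y <- k) lmul h (lmul y (lmul (S x) f)) a m =
  \sw_(x, y <- k) lmul (y * h) (lmul (S x) f) a m.
Proof.
move=> fB Aa.
transitivity (\sw_(x, y <- k) \sw_(c, d <- x) \sw_(u, v <- y) \sw_(s, t <- h)
    f (pact (S d) (pact u (pact s a))) (S c * (v * (t * m)))).
  apply: eq_sw => x y; rewrite /lmul [RHS]sw_exchange.
  rewrite sw_exchange; apply: eq_sw => u v; rewrite [RHS]sw_exchange; apply: eq_sw => s t.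
  by rewrite (swS HH) //; lin.
transitivity (\sw_(x, y <- k) \sw_(c, d <- x) \sw_(u, v <- y) \sw_(s, t <- h)
    f (pact (S d) (pact (u * s) a)) (S c * (v * (t * m)))); last first.
  apply: eq_sw => x y; rewrite /lmul (swM HH); last by lin.
  rewrite sw_exchange; apply: eq_sw => u v; rewrite sw_exchange; apply: eq_sw => s t.
  by rewrite (swS HH); [apply: eq_sw => c d; rewrite !mulrA | lin].
rewrite !sw_regroup4; [|lin|move=> ?; lin|lin|move=> ?; lin].
apply: eq_sw => c w; apply: eq_sw => e v.
rewrite sw_exchange [RHS]sw_exchange; apply: eq_sw => s t.
rewrite -!(balanced_sw fB); [|apar|apar].
by rewrite pact_rel4.
Qed.

End Balanced.
End Operators.

(** * Endomorphism algebras and generation *)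

Section Endomorphisms.
Variables (F : fieldType) (V : lmodType F).

(** The nonzero vector sits in the type because an [algType] requires 1 to differ from 0. *)
Record lend (v : V) (v0 : v != 0) := Lend { lend_fun :> V -> V; lendP : lin_map lend_fun }.

Variables (v : V) (v0 : v != 0).
Local Notation E := (lend v0).

Lemma lend_eq (f g : E) : (forall x, f x = g x) -> f = g.
Proof.
case: f g => [f fP] [g gP] /= fg; have e : f = g by apply/funext.
by case: g / e gP fg => gP _; congr Lend; exact: Prop_irrelevance.
Qed.

HB.instance Definition _ := gen_eqMixin E.
HB.instance Definition _ := gen_choiceMixin E.

Lemma lend_addP (f g : E) : lin_map (fun x => f x + g x).
Proof. by move=> c x y; rewrite !lendP scalerDr addrACA. Qed.
Lemma lend_oppP (f : E) : lin_map (fun x => - f x).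
Proof. by move=> c x y; rewrite lendP opprD scalerN. Qed.
Lemma lend_0P : lin_map (fun _ : V => 0 : V).
Proof. by move=> c x y; rewrite scaler0 addr0. Qed.
Lemma lend_scaleP (d : F) (f : E) : lin_map (fun x => d *: f x).
Proof. exact/lin_scaler/lendP. Qed.
Lemma lend_mulP (f g : E) : lin_map (fun x => g (f x)).
Proof. exact: (lin_comp (lendP g) (lendP f)). Qed.

Definition lend_add f g : E := Lend v0 (lend_addP f g).
Definition lend_opp f : E := Lend v0 (lend_oppP f).
Definition lend_0 : E := Lend v0 lend_0P.
Definition lend_scale d f : E := Lend v0 (lend_scaleP d f).
Definition lend_1 : E := Lend v0 (@lin_id F V).
(* Opposite composition: a right action becomes an algebra morphism. *)
Definition lend_mul f g : E := Lend v0 (lend_mulP f g).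

Fact lend_addA : associative lend_add.
Proof. by move=> f g h; apply: lend_eq => x /=; rewrite addrA. Qed.
Fact lend_addC : commutative lend_add.
Proof. by move=> f g; apply: lend_eq => x /=; rewrite addrC. Qed.
Fact lend_add0 : left_id lend_0 lend_add.
Proof. by move=> f; apply: lend_eq => x /=; rewrite add0r. Qed.
Fact lend_addN : left_inverse lend_0 lend_opp lend_add.
Proof. by move=> f; apply: lend_eq => x /=; rewrite addNr. Qed.
HB.instance Definition _ :=
  GRing.isZmodule.Build E lend_addA lend_addC lend_add0 lend_addN.

Fact lend_scaleA a b f : lend_scale a (lend_scale b f) = lend_scale (a * b) f.
Proof. by apply: lend_eq => x /=; rewrite scalerA. Qed.
Fact lend_scale1 : left_id 1 lend_scale.
Proof. by move=> f; apply: lend_eq => x /=; rewrite scale1r. Qed.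
Fact lend_scaleDr : right_distributive lend_scale +%R.
Proof. by move=> a f g; apply: lend_eq => x /=; rewrite scalerDr. Qed.
Fact lend_scaleDl f : {morph lend_scale^~ f : a b / a + b}.
Proof. by move=> a b; apply: lend_eq => x /=; rewrite scalerDl. Qed.
HB.instance Definition _ :=
  GRing.Zmodule_isLmodule.Build F E lend_scaleA lend_scale1 lend_scaleDr lend_scaleDl.

Fact lend_mulA : associative lend_mul.
Proof. by move=> f g h; apply: lend_eq. Qed.
Fact lend_mul1 : left_id lend_1 lend_mul.
Proof. by move=> f; apply: lend_eq. Qed.
Fact lend_mulr1 : right_id lend_1 lend_mul.
Proof. by move=> f; apply: lend_eq. Qed.
Fact lend_mulDl : left_distributive lend_mul +%R.
Proof. by move=> f g h; apply: lend_eq => x; exact: (lin_mapD (lendP h)). Qed.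
Fact lend_mulDr : right_distributive lend_mul +%R.
Proof. by move=> f g h; apply: lend_eq. Qed.
Fact lend_1neq0 : lend_1 != 0.
Proof.
by apply/eqP => /(congr1 (fun f : E => f v)) /= e; move: v0; rewrite [v]e eqxx.
Qed.
HB.instance Definition _ := GRing.Zmodule_isNzRing.Build E
  lend_mulA lend_mul1 lend_mulr1 lend_mulDl lend_mulDr lend_1neq0.

Fact lend_scaleAl (a : F) (f g : E) : a *: (f * g) = a *: f * g.
Proof. by apply: lend_eq => x; apply/esym; exact: (lin_mapZ (lendP g)). Qed.
HB.instance Definition _ := GRing.Lmodule_isLalgebra.Build F E lend_scaleAl.
Fact lend_scaleAr (a : F) (f g : E) : a *: (f * g) = f * (a *: g).
Proof. by apply: lend_eq. Qed.
HB.instance Definition _ := GRing.Lalgebra_isAlgebra.Build F E lend_scaleAr.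

Lemma lend_evalL (W : lmodType F) (g : V -> W) x :
  lin_map g -> lin_map (fun f : E => g (f x)).
Proof. by move=> gL c f h; exact: gL. Qed.
End Endomorphisms.

(** * Generation of H_par by the classes [h] *)

Section Generation.
Variables (F : fieldType) (H : algType F) (Delta : H -> seq (H * H)).
Variables (S : H -> H) (B : algType F) (pi : H -> B).
Hypothesis Hpi : is_Hpar Delta S pi.
Variable P : B -> Prop.
Hypothesis P1 : P 1.
Hypothesis PL : forall c x y, P x -> P y -> P (c *: x + y).
Hypothesis PM : forall x y, P x -> P y -> P (x * y).
Hypothesis Ppi : forall h, P (pi h).

Definition gen_pred : {pred B} := fun x => `[< P x >].

Fact gen_pred_closed : subalg_closed gen_pred.
Proof.
split; first exact/asboolP.
- by move=> c x y /asboolP Px /asboolP Py; apply/asboolP/PL.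
- by move=> x y /asboolP Px /asboolP Py; apply/asboolP/PM.
Qed.
HB.instance Definition _ := GRing.isSubalgClosed.Build F B gen_pred gen_pred_closed.

Record gen_alg := GenAlg { gen_val : B; _ : gen_val \in gen_pred }.
HB.instance Definition _ := [isSub for gen_val].
HB.instance Definition _ := [Choice of gen_alg by <:].
HB.instance Definition _ := [SubChoice_isSubAlgebra of gen_alg by <:].

(** The universal property maps B to the subalgebra cut out by [P]; followed by the inclusion it
    fixes every [h], so it is the identity by uniqueness. *)
Lemma Hpar_generated x : P x.
Proof.
have [piL [piR univ]] := Hpi.
have piP h : pi h \in gen_pred by apply/asboolP.
pose rho h : gen_alg := GenAlg (piP h).
have valL : lin_map (val : gen_alg -> B) by move=> c u v; exact: linearP.
have valM (u v : gen_alg) : val (u * v) = val u * val v by exact: rmorphM.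
have val1 : val (1 : gen_alg) = 1 by exact: rmorph1.
have rhoL : lin_map rho by move=> c u v; apply: val_inj; rewrite valL; exact: piL.
have rhoR : satisfies_Hpar_relations Delta S rho.
  have [p1 [r1 r2 r3 r4 r5]] := piR.
  split; first by apply: val_inj; rewrite val1.
  have vsum I (s : seq I) (f : I -> gen_alg) :
      val (\sum_(i <- s) f i) = \sum_(i <- s) val (f i) by exact: lin_map_sum.
  split=> [h k|h k|h k|h k|h]; apply: val_inj.
  - by rewrite !vsum -[RHS]r1; apply: eq_bigr => p _; rewrite !valM.
  - by rewrite !vsum -[RHS]r2; apply: eq_bigr => p _; rewrite !valM.
  - by rewrite !vsum -[RHS]r3; apply: eq_bigr => p _; rewrite !valM.
  - by rewrite !vsum -[RHS]r4; apply: eq_bigr => p _; rewrite !valM.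
  - rewrite [LHS]r5 vsum; apply: eq_bigr => p _.
    by rewrite vsum; apply: eq_bigr => q _; rewrite !valM.
have [[phi [[phiL phiM phi1] phipi]] _] := univ gen_alg rho rhoL rhoR.
have [_ uniq] := univ B pi piL piR.
have -> : x = val (phi x).
  apply: (uniq id (val \o phi)) => //= [|h]; last by rewrite phipi.
  by split=> [c u w|u w|] /=; rewrite ?phiL ?phiM ?phi1 ?valL ?valM ?val1.
exact/asboolP/(valP (phi x)).
Qed.
End Generation.

(** * The action of H_par on balanced maps *)

Section ActionOnBalanced.
Variables (F : fieldType) (H : algType F) (Delta : H -> seq (H * H)).
Variables (eps : H -> F) (S : H -> H) (Sinv : H -> H).
Hypothesis HH : is_weak_hopf_algebra Delta eps S.
Hypotheses (HS1 : cancel S Sinv) (HS2 : cancel Sinv S).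
Variables (B : algType F) (pi : H -> B).
Hypothesis Hpi : is_Hpar Delta S pi.
Variable U : lmodType F.
Local Notation "\sw_ ( a , b <- h ) E" := (sw Delta h (fun a b => E))
  (at level 41, a name, b name, h at level 70, E at level 41,
   format "\sw_ ( a ,  b  <-  h )  E").
Local Notation Ew := (Ew Delta S pi).
Local Notation pact := (pact Delta S pi).
Local Notation Apar := (Apar Delta S pi).
Local Notation balanced := (balanced Delta eps S pi Sinv).
Local Notation lmul := (lmul Delta S pi).
Implicit Types (f : B -> H -> U) (h k m : H).

Let piL : lin_map pi. Proof. by case: Hpi. Qed.
Let piR : satisfies_Hpar_relations Delta S pi. Proof. by case: Hpi => _ []. Qed.

(* Balanced maps are normalised to vanish outside A, where they are
   unconstrained, so that they form a vector space. *)
Definition bal_pred : {pred B -> H -> U} :=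
  fun f => `[< balanced f /\ forall a m, ~ Apar a -> f a m = 0 >].

Fact bal_pred_closed : submod_closed bal_pred.
Proof.
split.
  apply/asboolP; split=> //; split=> *; rewrite ?scaler0 ?addr0 //.
move=> c f g /asboolP [[f1 f2 f3] f0] /asboolP [[g1 g2 g3] g0].
apply/asboolP; split=> [|a m Aa].
  split=> [d a a' m Aa Aa'|d a m m' Aa|a z m Aa zT] /=.
  - change (c *: f (d *: a + a') m + g (d *: a + a') m =
      d *: (c *: f a m + g a m) + (c *: f a' m + g a' m)).
    by rewrite f1 // g1 // !scalerDr !scalerA mulrC addrACA.
  - change (c *: f a (d *: m + m') + g a (d *: m + m') =
      d *: (c *: f a m + g a m) + (c *: f a m' + g a m')).
    by rewrite f2 // g2 // !scalerDr !scalerA mulrC addrACA.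
  - change (c *: f (rtri Delta S pi Sinv a z) m + g (rtri Delta S pi Sinv a z) m =
      c *: f a (z * m) + g a (z * m)).
    by rewrite f3 // g3.
change (c *: f a m + g a m = 0).
by rewrite f0 // g0 // scaler0 addr0.
Qed.
HB.instance Definition _ := GRing.isSubmodClosed.Build F (B -> H -> U) bal_pred bal_pred_closed.

Record bal := Bal { bal_val : B -> H -> U; _ : bal_val \in bal_pred }.
HB.instance Definition _ := [isSub for bal_val].
HB.instance Definition _ := [Choice of bal by <:].
HB.instance Definition _ := [SubChoice_isSubLmodule of bal by <:].

Lemma bal_balanced (X : bal) : balanced (val X).
Proof. by have /asboolP [] := valP X. Qed.

Definition restrict f : B -> H -> U := fun a m => if `[< Apar a >] then f a m else 0.

Lemma restrictE f a m : Apar a -> restrict f a m = f a m.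
Proof. by move=> Aa; rewrite /restrict asboolT. Qed.

Lemma eq_balanced f g : (forall a m, Apar a -> f a m = g a m) ->
  balanced f -> balanced g.
Proof.
move=> fg [f1 f2 f3]; split=> [c a a' m Aa Aa'|c a m m' Aa|a z m Aa zT].
- rewrite -!fg ?f1 //; apply: Apar_add => //; exact: Apar_scale.
- by rewrite -!fg // f2.
- rewrite -!fg ?f3 //; apply: Apar_mul => //; exact: (Apar_pact HH piL piR _ (Apar_1 _ _ _)).
Qed.

Lemma restrict_bal f : balanced f -> restrict f \in bal_pred.
Proof.
move=> fB; apply/asboolP; split=> [|a m nAa]; last by rewrite /restrict asboolF.
by apply: eq_balanced fB => a m Aa; rewrite restrictE.
Qed.

Definition mkbal f : bal :=
  if pselect (balanced f) is left fB then Bal (restrict_bal fB) else 0.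

Lemma mkbalE f a m : balanced f -> Apar a -> val (mkbal f) a m = f a m.
Proof.
by move=> fB Aa; rewrite /mkbal; case: pselect => //= fB'; exact: restrictE.
Qed.

Lemma bal_eq (X Y : bal) :
  (forall a m, Apar a -> val X a m = val Y a m) -> X = Y.
Proof.
move=> XY; apply: val_inj; apply/funext => a; apply/funext => m.
have [Aa|nAa] := pselect (Apar a); first exact: XY.
by have /asboolP [_ ->] := valP X => //; have /asboolP [_ ->] := valP Y.
Qed.

Lemma mkbalK (X : bal) : mkbal (val X) = X.
Proof. by apply: bal_eq => a m Aa; rewrite mkbalE //; exact: bal_balanced. Qed.

Lemma bal_evalL a m : lin_map (fun X : bal => val X a m).
Proof. by move=> c X Y; rewrite linearP. Qed.

Definition balmul h (X : bal) : bal := mkbal (lmul h (val X)).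

Lemma balmulE h X a m : Apar a -> val (balmul h X) a m = lmul h (val X) a m.
Proof.
move=> Aa; rewrite mkbalE //; apply: (balanced_lmul HH HS1 HS2 piL piR).
exact: bal_balanced.
Qed.

Lemma eq_lmul h f g a m : (forall a m, Apar a -> f a m = g a m) -> Apar a ->
  lmul h f a m = lmul h g a m.
Proof.
by move=> fg Aa; apply: eq_sw => x y; apply: fg; exact: (Apar_pact HH piL piR).
Qed.

Lemma balmulL h : lin_map (balmul h).
Proof.
move=> c X Y; apply: bal_eq => a m Aa; rewrite bal_evalL !balmulE //.
by apply: lmul_lin => a' m'; exact: bal_evalL.
Qed.

Lemma balanced_action_nontrivial (X0 : bal) : X0 != 0 ->
  exists T : B -> bal -> bal,
    [/\ forall x, lin_map (T x), forall X, lin_map (T^~ X),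
        forall x y X, T (x * y) X = T y (T x X), forall X, T 1 X = X
      & forall h X, T (pi h) X = balmul h X].
Proof.
move=> nz; have [_ [_ univ]] := Hpi.
pose C : algType F := lend nz.
pose rho h : C := Lend nz (balmulL h).
have evL X a m : lin_map (fun f : C => val (f X) a m).
  exact: (lend_evalL (g := fun X => val X a m) X (bal_evalL a m)).
have C_eq (f g : C) : (forall X a m, Apar a -> val (f X) a m = val (g X) a m) -> f = g.
  by move=> fg; apply: lend_eq => X; apply: bal_eq => a m; exact: fg.
have rhoL : lin_map rho.
  move=> c h k; apply: C_eq => X a m Aa; rewrite evL /= !balmulE //.
  exact: (lmulL HH piL piR m (bal_balanced X) Aa).
have m2 h k X a m : Apar a ->
    val ((rho h * rho k) X) a m = lmul k (lmul h (val X)) a m.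
  move=> Aa; rewrite /= balmulE //; apply: eq_lmul => // a' m' Aa'; exact: balmulE.
have m3 h k g X a m : Apar a ->
    val ((rho h * rho k * rho g) X) a m = lmul g (lmul k (lmul h (val X))) a m.
  move=> Aa; rewrite /= balmulE //; apply: eq_lmul => // a' m' Aa'.
  exact: m2.
have evsum X a m I (s : seq I) (f : I -> C) :
    val ((\sum_(i <- s) f i) X) a m = \sum_(i <- s) val (f i X) a m.
  exact: (lin_map_sum (evL X a m)).
have rhoR : satisfies_Hpar_relations Delta S rho.
  split.
    apply: C_eq => X a m Aa; rewrite /= balmulE //.
    by apply: (lmul1 HH HS1 HS2 piL piR) => //; exact: bal_balanced.
  split=> [h k|h k|h k|h k|h]; apply: C_eq => X a m Aa; have XB := bal_balanced X.
  - rewrite !evsum; apply: etrans (etrans (lmul_rel1 HH HS1 HS2 piL piR h k m XB Aa) _).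
      by apply: eq_bigr => p _; rewrite m3.
    by apply: eq_bigr => p _; rewrite m2.
  - rewrite !evsum; apply: etrans (etrans (lmul_rel2 HH piL piR h k m XB Aa) _).
      by apply: eq_bigr => p _; rewrite m3.
    by apply: eq_bigr => p _; rewrite m2.
  - rewrite !evsum; apply: etrans (etrans (lmul_rel3 HH HS1 HS2 piL piR h k m XB Aa) _).
      by apply: eq_bigr => p _; rewrite m3.
    by apply: eq_bigr => p _; rewrite m2.
  - rewrite !evsum; apply: etrans (etrans (lmul_rel4 HH piL piR k h m XB Aa) _).
      by apply: eq_bigr => p _; rewrite m3.
    by apply: eq_bigr => p _; rewrite m2.
  - rewrite [LHS]balmulE // evsum -(lmul_rel5 HH HS1 HS2 piL piR) //.
    apply: eq_bigr => p _; rewrite evsum; apply: eq_bigr => q _; by rewrite m3.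
have [[phi [[phiL phiM phi1] phipi]] _] := univ C rho rhoL rhoR.
exists (fun x => lend_fun (phi x)); split=> [x|X c x y|x y X|X|h X].
- exact: lendP.
- by rewrite phiL.
- by rewrite phiM.
- by rewrite phi1.
- by rewrite phipi.
Qed.

Lemma balanced_action :
  exists T : B -> (B -> H -> U) -> B -> H -> U,
    [/\ forall x f, balanced f -> balanced (T x f),
        forall f a m, balanced f -> Apar a -> lin_map (fun x => T x f a m),
        forall x y f a m, balanced f -> Apar a -> T (x * y) f a m = T y (T x f) a m,
        forall f a m, balanced f -> Apar a -> T 1 f a m = f a m
      & forall h f a m, balanced f -> Apar a -> T (pi h) f a m = lmul h f a m].
Proof.
have [[X0 nz]|triv] := pselect (exists X : bal, X != 0).
  have [T [TL1 TL2 TM T1 Tpi]] := balanced_action_nontrivial nz.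
  exists (fun x f => val (T x (mkbal f))); split=> [x f fB|f a m fB Aa|x y f a m fB Aa|f a m fB Aa|h f a m fB Aa].
  - exact: bal_balanced.
  - by move=> c x y; rewrite TL2 bal_evalL.
  - by rewrite TM mkbalK.
  - by rewrite T1 mkbalE.
  - by rewrite Tpi balmulE //; apply: eq_lmul => // a' m' Aa'; rewrite mkbalE.
have z f a m : balanced f -> Apar a -> f a m = 0.
  move=> fB Aa; rewrite -(mkbalE m fB Aa).
  have -> : mkbal f = 0 by apply/eqP/negP => /negP nz; apply: triv; exists (mkbal f).
  by rewrite raddf0.
exists (fun x f => f); split=> //.
  by move=> f a m fB Aa c x y; rewrite !(z f) // scaler0 addr0.
move=> h f a m fB Aa; rewrite (z f) // (z (lmul h f)) //.
exact: (balanced_lmul HH HS1 HS2 piL piR).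
Qed.

End ActionOnBalanced.

(** * The isomorphism *)

Section Isomorphism.
Variables (F : fieldType) (H : algType F) (Delta : H -> seq (H * H)).
Variables (eps : H -> F) (S : H -> H) (Sinv : H -> H).
Hypothesis HH : is_weak_hopf_algebra Delta eps S.
Hypotheses (HS1 : cancel S Sinv) (HS2 : cancel Sinv S).
Variables (B : algType F) (pi : H -> B).
Hypothesis Hpi : is_Hpar Delta S pi.
Local Notation "\sw_ ( a , b <- h ) E" := (sw Delta h (fun a b => E))
  (at level 41, a name, b name, h at level 70, E at level 41,
   format "\sw_ ( a ,  b  <-  h )  E").
Local Notation Ew := (Ew Delta S pi).
Local Notation pact := (pact Delta S pi).
Local Notation Apar := (Apar Delta S pi).
Local Notation balanced := (balanced Delta eps S pi Sinv).
Local Notation lmul := (lmul Delta S pi).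
Local Notation inAH := (inAH Delta S pi).
Local Notation smul := (smul Delta S pi).
Local Notation pgen := (pgen Delta S pi).
Local Notation teqS := (teqS Delta eps S pi Sinv).
Local Notation PSP := (PSP Delta eps S pi Sinv).
Implicit Types (h k m : H) (s t : seq (B * H)).

Let piL : lin_map pi. Proof. by case: Hpi. Qed.
Let piR : satisfies_Hpar_relations Delta S pi. Proof. by case: Hpi => _ []. Qed.

(* The inverse isomorphism a # h |-> a [h]. *)
Definition ev s : B := \sum_(p <- s) p.1 * pi p.2.

Lemma inAH_cat s t : inAH (s ++ t) <-> inAH s /\ inAH t.
Proof.
split=> [st|[As At] p]; last by rewrite mem_cat => /orP [/As|/At].
by split=> p ps; apply: st; rewrite mem_cat ps ?orbT.
Qed.

Lemma inAH_cons p s : inAH (p :: s) <-> Apar p.1 /\ inAH s.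
Proof.
split=> [As|[Ap As] q]; last by rewrite inE => /predU1P [->|/As].
by split=> [|q qs]; apply: As; rewrite inE ?eqxx // qs orbT.
Qed.

Lemma smulP s t q : q \in smul s t ->
  exists p r, [/\ p \in s, r \in t & exists x, q.1 = p.1 * pact x r.1].
Proof.
move=> /flattenP [l /allpairsP [[p r] /= [ps rt ->]] /mapP [x _ ->]].
by exists p, r; split=> //; exists x.1.
Qed.

Lemma inAH_smul s t : inAH s -> inAH t -> inAH (smul s t).
Proof.
move=> As At q /smulP [p [r [/As Ap /At Ar [x ->]]]]; apply: Apar_mul => //.
exact: (Apar_pact HH piL piR).
Qed.

Lemma inAH_pgen a h : Apar a -> inAH (pgen a h).
Proof.
move=> Aa; apply: inAH_smul => p; rewrite inE => /eqP -> //; exact: Apar_1.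
Qed.

Lemma sum_smul (U : lmodType F) (f : B -> H -> U) s t :
  \sum_(p <- smul s t) f p.1 p.2 =
  \sum_(p <- s) \sum_(r <- t)
     \sw_(x, y <- p.2) f (p.1 * pact x r.1) (y * r.2).
Proof.
rewrite /Defs.smul big_flatten big_allpairs_dep /=.
by apply: eq_bigr => p _; apply: eq_bigr => r _; rewrite big_map.
Qed.

Lemma sum_pgen (U : lmodType F) (f : B -> H -> U) a h :
  \sum_(p <- pgen a h) f p.1 p.2 = \sw_(x, y <- h) f (a * Ew x) y.
Proof.
rewrite sum_smul !big_seq1 /=; apply: eq_sw => x y.
by rewrite mulr1 pact1.
Qed.

Lemma balanced_ev : balanced (fun a h => a * pi h).
Proof.
split=> [c a a' h _ _|c a h h' _|a z h Aa /(in_Ht_is_t HH) zT].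
- by rewrite mulrDl scalerAl.
- by rewrite piL mulrDr scalerAr.
- by rewrite (rtriE HH HS1 HS2 piL piR) // (pi_tM HH piL piR) // mulrA.
Qed.

Lemma ev_pgen a h : ev (pgen a h) = a * pi h.
Proof.
rewrite /ev (sum_pgen (fun a h => a * pi h)) -(sw_Ew_pi piR h) sw_mull.
by apply: eq_sw => x y; rewrite mulrA.
Qed.

(** [h] b [g] = (h_1 . b) E_{h_2} [h_3 g], and E_{h_2} is absorbed since (h_1 . b) E_{h_2} = h .
    b. *)
Lemma ev_smul s t : inAH t -> ev (smul s t) = ev s * ev t.
Proof.
move=> At; rewrite /ev (sum_smul (fun a h => a * pi h)) mulr_suml.
apply: eq_bigr => p _; rewrite mulr_sumr; apply: eq_big_seq => r /At Ar.
rewrite -mulrA [pi _ * (_ * _)]mulrA (pi_mul_Apar HH piL piR) // sw_mulr sw_mull.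
transitivity (\sw_(x, y <- p.2) \sw_(u, v <- y)
    p.1 * (pact x r.1 * (Ew u * pi (v * r.2)))); last first.
  by apply: eq_sw => x y; rewrite -mulrA (piM HH piL piR) !sw_mull.
rewrite -(sw_coassoc HH _ (f := fun x u v =>
   p.1 * (pact x r.1 * (Ew u * pi (v * r.2))))); last by lin.
apply: eq_sw => x y; rewrite -(pact_Ew_r HH piL piR x Ar) sw_mull sw_mulr.
by apply: eq_sw => u v; rewrite !mulrA.
Qed.

Lemma Hpar_spanned x : exists s, inAH s /\ x = ev s.
Proof.
pose P x := exists s, inAH s /\ x = ev s.
have Pgen a h : Apar a -> P (a * pi h).
  move=> Aa; exists [:: (a, h)]; rewrite /ev big_seq1; split=> // p.
  by rewrite inE => /eqP ->.
have PL c u v : P u -> P v -> P (c *: u + v).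
  move=> [s [As ->]] [t [At ->]]; exists ([seq (c *: p.1, p.2) | p <- s] ++ t).
  split; last first.
    rewrite /ev big_cat big_map /= scaler_sumr; congr (_ + _).
    by apply: eq_bigr => p _; rewrite scalerAl.
  apply/inAH_cat; split=> // q /mapP [p ps ->]; apply: Apar_scale; exact: As.
have P0 : P 0 by exists [::]; rewrite /ev big_nil.
have Psum (I : eqType) (r : seq I) g : (forall i, i \in r -> P (g i)) -> P (\sum_(i <- r) g i).
  elim: r => [|i r IH] Pg; first by rewrite big_nil.
  rewrite big_cons -[g i]scale1r; apply: PL; first by apply: Pg; rewrite inE eqxx.
  by apply: IH => j jr; apply: Pg; rewrite inE jr orbT.
move: x; apply: (Hpar_generated Hpi (P := P)) => //.
- by rewrite -(mulr1 1) -{2}(pi1 piR); apply: Pgen; exact: Apar_1.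
- move=> u v [s [As ->]] [t [At ->]]; exists (smul s t).
  by rewrite ev_smul //; split=> //; exact: inAH_smul.
by move=> h; rewrite -[pi h]mul1r; apply: Pgen; exact: Apar_1.
Qed.

(* [pgens s] is s multiplied on the right by the idempotent 1 # 1. *)
Definition pgens s : seq (B * H) := flatten [seq pgen p.1 p.2 | p <- s].

Lemma inAH_pgens s : inAH s -> inAH (pgens s).
Proof.
by move=> As q /flattenP [l /mapP [p /As Ap ->]]; exact: inAH_pgen.
Qed.

Lemma ev_pgens s : ev (pgens s) = ev s.
Proof.
rewrite /ev big_flatten big_map /=; apply: eq_bigr => p _; exact: ev_pgen.
Qed.

Lemma PSP_pgens s : inAH s -> PSP (pgens s).
Proof.
elim: s => [_|p s IH /inAH_cons [Ap As]]; last first.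
  by apply: PSP_add (IH As); apply: PSP_gen => //; exact: inAH_pgen.
have A1 : Apar 1 by exact: Apar_1.
(* [PSP] has no constructor for zero, so the empty list is reached as the scalar 0 times a
   generator. *)
apply: (PSP_eq (s := sscale 0 (pgen 1 1))); last first.
  by apply: PSP_scale; apply: PSP_gen => //; exact: inAH_pgen.
split; first by move=> q /mapP [p _ ->]; rewrite /= scale0r; exact: Apar0.
split=> // U f fB; rewrite big_nil big_map big1 // => p _ /=.
by rewrite scale0r (balanced0 fB).
Qed.

(** * Sums over smash products, computed by the action *)

Section Functional.
Variables (U : lmodType F) (T : B -> (B -> H -> U) -> B -> H -> U).
Hypothesis TB : forall x f, balanced f -> balanced (T x f).
Hypothesis TL : forall f a m, balanced f -> Apar a -> lin_map (fun x => T x f a m).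
Hypothesis TM : forall x y f a m, balanced f -> Apar a ->
  T (x * y) f a m = T y (T x f) a m.
Hypothesis T1 : forall f a m, balanced f -> Apar a -> T 1 f a m = f a m.
Hypothesis Tpi : forall h f a m, balanced f -> Apar a -> T (pi h) f a m = lmul h f a m.

(** On a generator E_h this is [lmul_S1]; the opposite order of composition makes the formula stable
    under products. *)
Lemma T_Apar e f a m : Apar e -> balanced f -> Apar a -> T e f a m = f (e * a) m.
Proof.
move=> Ae; elim: Ae f a m => [h||x y Ax IHx Ay IHy|c x Ax IHx|x y Ax IHx Ay IHy] f a m fB Aa.
- have gL := TL m fB Aa.
  rewrite EwE (lin_sw (g := fun x => T x f a m)) // -(lmul_S1 HH HS1 HS2 piL piR h m fB Aa).
  apply: eq_sw => x y; rewrite TM // Tpi //; last exact: TB.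
  by apply: (eq_lmul HH Hpi) => // a' m' Aa'; rewrite Tpi.
- by rewrite T1 // mul1r.
- rewrite (lin_mapD (TL m fB Aa)) IHx // IHy // mulrDl.
  case: (fB) => fL _ _; rewrite -[x * a]scale1r fL ?scale1r //; exact: Apar_mul.
- by rewrite (lin_mapZ (TL m fB Aa)) IHx // -scalerAl (balancedZ fB) //; exact: Apar_mul.
- by rewrite TM // IHy ?IHx ?mulrA //; [exact: Apar_mul | exact: TB].
Qed.

(** The list s enters the right side only through [ev s]; taking t = 1 # 1 yields the
    well-definedness of the isomorphism. *)
Lemma sum_smul_T f s t : balanced f -> inAH s -> inAH t ->
  \sum_(p <- smul s t) f p.1 p.2 = \sum_(r <- t) T (ev s) f r.1 r.2.
Proof.
move=> fB As At; rewrite sum_smul exchange_big; apply: eq_big_seq => r /At Ar /=.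
rewrite (lin_map_sum (TL r.2 fB Ar)); apply: eq_big_seq => p /As Ap.
rewrite TM // Tpi //; last exact: TB.
apply: eq_sw => x y; rewrite T_Apar //; exact: (Apar_pact HH piL piR).
Qed.

Lemma sum_pgens_T f s : balanced f -> inAH s ->
  \sum_(p <- pgens s) f p.1 p.2 = T (ev s) f 1 1.
Proof.
move=> fB As; have A1 : Apar 1 by exact: Apar_1.
rewrite (lin_map_sum (TL 1 fB A1)) big_flatten big_map; apply: eq_big_seq => p /As Ap.
have := @sum_smul_T f [:: (p.1, p.2)] [:: (1, 1)] fB.
rewrite big_seq1 /ev big_seq1; apply=> q; rewrite inE => /eqP -> //.
Qed.
End Functional.

Definition repr x : seq (B * H) := sval (cid (Hpar_spanned x)).

Lemma reprP x : inAH (repr x) /\ x = ev (repr x).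
Proof. by rewrite /repr; case: cid. Qed.

Definition smash_of x := pgens (repr x).

Lemma inAH_smash_of x : inAH (smash_of x).
Proof. by apply: inAH_pgens; case: (reprP x). Qed.

Lemma ev_smash_of x : ev (smash_of x) = x.
Proof. by rewrite ev_pgens; case: (reprP x). Qed.

Lemma ev_teqS s t : teqS s t -> ev s = ev t.
Proof. by move=> [_ [_ st]]; exact: (st B _ balanced_ev). Qed.

Lemma smash_of_unique x s : inAH s -> x = ev s -> teqS (smash_of x) (pgens s).
Proof.
move=> As xs; split; first exact: inAH_smash_of.
split=> [|U f fB]; first exact: inAH_pgens.
have [T [TB TL TM T1 Tpi]] := balanced_action HH HS1 HS2 Hpi U.
have [Ax ex] := reprP x.
by rewrite !(sum_pgens_T TB TL TM T1 Tpi) // -ex -xs.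
Qed.

Lemma teqS_trans s t r : teqS s t -> teqS t r -> teqS s r.
Proof.
move=> [As [At st]] [_ [Ar tr]]; split=> //; split=> // U f fB.
by rewrite st // tr.
Qed.

Lemma smash_ofL c x y :
  teqS (smash_of (c *: x + y)) (sadd (sscale c (smash_of x)) (smash_of y)).
Proof.
split; first exact: inAH_smash_of.
split=> [|U f fB].
  apply/inAH_cat; split; last exact: inAH_smash_of.
  by move=> q /mapP [p ps ->]; apply: Apar_scale; exact: (inAH_smash_of ps).
have [T [TB TL TM T1 Tpi]] := balanced_action HH HS1 HS2 Hpi U.
have A1 : Apar 1 by exact: Apar_1.
have E z : \sum_(p <- smash_of z) f p.1 p.2 = T z f 1 1.
  by have [Az ez] := reprP z; rewrite (sum_pgens_T TB TL TM T1 Tpi) // -ez.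
rewrite big_cat big_map /= !E (TL f 1 1 fB A1) -E scaler_sumr; congr (_ + _).
by apply: eq_big_seq => p /inAH_smash_of Ap; rewrite (balancedZ fB).
Qed.

(** T(xy) f = T(y)(T(x) f), so for x = [ev s] the assumption on t is applied to the balanced map
    T(x) f in place of f. *)
Lemma smash_of_smul s t : inAH s -> teqS (smash_of (ev t)) t -> 
  teqS (smash_of (ev s * ev t)) (smul s t).
Proof.
move=> As tt; have [_ [At tU]] := tt.
split; first exact: inAH_smash_of.
split=> [|U f fB]; first exact: inAH_smul.
have [T [TB TL TM T1 Tpi]] := balanced_action HH HS1 HS2 Hpi U.
have A1 : Apar 1 by exact: Apar_1.
have E g z : balanced g -> \sum_(p <- smash_of z) g p.1 p.2 = T z g 1 1.
  by move=> gB; have [Az ez] := reprP z; rewrite (sum_pgens_T TB TL TM T1 Tpi) // -ez.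
rewrite (sum_smul_T TB TL TM T1 Tpi) // E // TM // -E; last exact: TB.
by apply: tU; exact: TB.
Qed.

Lemma teqS_smash_of_smash_of x : teqS (smash_of (ev (smash_of x))) (smash_of x).
Proof.
rewrite ev_smash_of; have A := @inAH_smash_of x.
by split=> //; split.
Qed.

(** On the partial smash product [ev] is thus a two-sided inverse; this yields surjectivity and,
    applied to the unit, unitality. *)
Lemma PSP_smash_of s : PSP s -> teqS (smash_of (ev s)) s.
Proof.
elim=> [a h Aa _|t u _ IHt _ IHu|c t _ IHt|t u _ IHt _ IHu|t u tu _ IHt].
- have As : inAH [:: (a, h)] by move=> p; rewrite inE => /eqP ->.
  have := smash_of_unique As erefl; rewrite /pgens /= cats0.
  by rewrite ev_pgen {1}/ev big_seq1.
- have -> : ev (sadd t u) = 1 *: ev t + ev u by rewrite scale1r /ev big_cat.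
  apply: teqS_trans (smash_ofL _ _ _) _.
  have [_ [At tU]] := IHt; have [_ [Au uU]] := IHu.
  split; first by case: (smash_ofL 1 (ev t) (ev u)) => _ [].
  split=> [|U f fB]; first by apply/inAH_cat.
  rewrite !big_cat big_map /= uU // -tU //; congr (_ + _).
  by apply: eq_bigr => p _; rewrite scale1r.
(* Zero is written as [ev [::]] so that [smash_ofL], stated for c x + y, covers pure scaling. *)
- have -> : ev (sscale c t) = c *: ev t + ev [::].
    by rewrite /ev big_nil addr0 scaler_sumr big_map; apply: eq_bigr => p _; rewrite scalerAl.
  apply: teqS_trans (smash_ofL _ _ _) _.
  have [At' [At tU]] := IHt.
  have N : inAH [::] by [].
  have [_ [_ nU]] := smash_of_unique N erefl.
  split; first by case: (smash_ofL c (ev t) (ev [::])) => _ [].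
  split=> [|U f fB]; first by move=> q /mapP [p pt ->]; apply: Apar_scale; exact: At.
  rewrite big_cat !big_map nU //= big_nil addr0.
  have e r : inAH r -> \sum_(p <- r) f (c *: p.1) p.2 = c *: \sum_(p <- r) f p.1 p.2.
    by move=> Ar; rewrite scaler_sumr; apply: eq_big_seq => p /Ar Ap; rewrite (balancedZ fB).
  by rewrite /= !e // tU.
- have [_ [Au _]] := IHu; rewrite ev_smul //; apply: smash_of_smul => //.
  by case: IHt => _ [].
- by rewrite -(ev_teqS tu); exact: teqS_trans IHt tu.
Qed.

Lemma smash_of_iso : iso_to_partial_smash Delta eps S pi Sinv smash_of.
Proof.
split; first by move=> x; apply: PSP_pgens; case: (reprP x).
split=> [|x y||x y xy|s /PSP_smash_of ss].
- exact: smash_ofL.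
- rewrite -{1}(ev_smash_of x) -{1}(ev_smash_of y).
  apply: smash_of_smul; [exact: inAH_smash_of | exact: teqS_smash_of_smash_of].
- have A1 : Apar 1 by exact: Apar_1.
  have <- : ev (sunit Delta S pi) = 1 by rewrite ev_pgen (pi1 piR) mulr1.
  by apply: PSP_smash_of; apply: PSP_gen => //; exact: inAH_pgen.
- by rewrite -(ev_smash_of x) -(ev_smash_of y); exact: ev_teqS.
by exists (ev s).
Qed.

End Isomorphism.

Theorem theorem4p7 (F : fieldType) (H : algType F)
  (Delta : H -> seq (H * H)) (eps : H -> F) (S Sinv : H -> H)
  (HH : is_weak_hopf_algebra Delta eps S)
  (HS1 : cancel S Sinv) (HS2 : cancel Sinv S)
  (B : algType F) (pi : H -> B) (Hpi : is_Hpar Delta S pi) :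
  exists phi : B -> seq (B * H),
    iso_to_partial_smash Delta eps S pi Sinv phi.
Proof. by exists (smash_of HH Hpi); exact: smash_of_iso. Qed.
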